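(* Let $\lambda(t)$, $c(t)$ and the initial condition $(x(0),\beta(0))$, with $x(0)\in\mathbb{R}_{\ge0}^{\mathcal E}$, be such that: (a) the external inflow functions $\lambda_i$, the capacity functions $c_i$, and the initial outflow histories $z_i$ (on $[-\bar\delta,0)$), $i\in\mathcal E$, are nonnegative and piecewise constant; (b) all $\lambda_i$ and $c_i$, $i\in\mathcal E$, are periodic with the same period $T>0$; (c) the stability condition holds: there exists $\epsilon>0$ such that $[I-R^T]\bar c>\bar\lambda+\epsilon\mathbf 1$ (entrywise), where $\bar\lambda_i:=\frac1T\int_0^T\lambda_i(t)\,dt$ and $\bar c_i:=\frac1T\int_0^Tc_i(t)\,dt$. Then there exists a unique periodic state trajectory $(x^*,z^* )$ with period $T$ for the traffic flow model, to which every trajectory converges.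
   Context: Road network: a finite directed multigraph $\mathcal G=(\mathcal V,\mathcal E)$ without self-loops; $\mathcal E$ is the set of links. $R\in\mathbb{R}_{\ge0}^{\mathcal E\times\mathcal E}$ is the routing matrix: $R_{ji}$ is the fraction of the flow leaving link $j$ that goes to link $i$, with $R_{ji}=0$ if $i$ is not immediately downstream of $j$. $R$ is sub-stochastic: nonnegative entries, all row sums at most $1$, at least one row sum strictly less than $1$. Standing connectivity assumption: (i) for every $i,j\in\mathcal E$ there is a directed path from $i$ to $j$ or from $j$ to $i$; (ii) for every $i\in\mathcal E$, either the $i$-th row sum of $R$ is strictly less than $1$, or there is a directed path (along links with consecutive positive entries of $R$) from $i$ to some link $j$ whose row sum in $R$ is strictly less than $1$. In particular the spectral radius of $R$ is strictly less than $1$. $\delta_{ji}\ge0$ is the travel time from link $j$ to link $i$; $\mathcal E_i:=\{j\in\mathcal E: R_{ji}>0,\ \delta_{ji}=0\}$; $\bar\delta_j:=\max\{\delta_{ji}: i\in\mathcal E,R_{ji}>0\}$; $\bar\delta:=\max_{(j,i):R_{ji}>0}\delta_{ji}$. $\lambda_i,c_i:\mathbb{R}_{\ge0}\to\mathbb{R}_{\ge0}$ are the external inflow and capacity functions. A function on a bounded interval is piecewise constant if the interval can be partitioned into finitely many contiguous right-open intervals on each of which the function is constant; for $\lambda_i,c_i$ this is required over one period. Traffic flow model: the state is $(x(t),\beta(t))$ with queue lengths $x(t)$ and past departures $\beta(t):=\{z_j(s): s\in[t-\bar\delta_j,t)\}_{j\in\mathcal E}$. The queue lengths satisfy, for $t\ge0$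 (with $x$ absolutely continuous and the equation holding for almost every $t$), $$\dot x_i(t)=\tilde\lambda_i(t)+\sum_{j\in\mathcal E_i}R_{ji}z_j(x(t),t)-z_i(x(t),t),\quad i\in\mathcal E,\qquad \tilde\lambda_i(t):=\lambda_i(t)+\sum_{j\in\mathcal E\setminus\mathcal E_i}R_{ji}z_j(t-\delta_{ji}),$$ where $z_j(s)=z_j(x(s),s)$ for $s\ge 0$, $z_j(s)$ for $s<0$ is given by $\beta(0)$, and for each $t\ge0$ the outflow vector $z(x(t),t)$ is the (unique, $\eta$-independent) solution of: maximize $\eta^Tz$ over $z\in\mathbb{R}^{\mathcal E}$ subject to $z_i\le c_i(t)$ for all $i\in\mathcal E$ and $z_i\le\tilde\lambda_i(t)+\sum_{j\in\mathcal E_i}R_{ji}z_j$ for all $i\in\mathcal I(x(t)):=\{i\in\mathcal E:x_i(t)=0\}$, for any $\eta\in\mathbb{R}_{>0}^{\mathcal E}$. The solution may be described equivalently by $(x(t),\beta(t))$ or by $(x(t),z(t))$. Convergence of a trajectory $(x,\beta)$ to $(x^*,\beta^* )$ (equivalently to $(x^*,z^* )$) means $\|x(t)-x^*(t)\|_1\to0$ and $\|\beta(t)-\beta^*(t)\|_1\to0$ as $t\to\infty$, where $\|\beta(t)-\beta^*(t)\|_1:=\sum_{i\in\mathcal E}\sum_{j\in\mathcal E}R_{ji}\int_{t-\delta_{ji}}^t|z_j(s)-z_j^*(s)|\,ds$. ''Every trajectory'' means every solution whose initial condition satisfies (a). *)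

(* Defs.v *)
From HB Require Import structures.
From mathcomp Require Import all_boot all_order all_algebra.
From mathcomp Require Import all_classical all_reals all_analysis.

Set Implicit Arguments.
Unset Strict Implicit.
Unset Printing Implicit Defensive.

Import Order.TTheory GRing.Theory Num.Theory.
Import numFieldNormedType.Exports.

Local Open Scope classical_set_scope.
Local Open Scope ring_scope.

Definition absolutely_continuous (R : realType) (a b : R) (f : R -> R) : Prop :=
  forall e : R, 0 < e ->
  exists2 d : R, 0 < d &
    forall (n : nat) (u v : 'I_n -> R),
      (forall k, a <= u k /\ u k <= v k /\ v k <= b) ->
      trivIset [set: 'I_n] (fun k => `]u k, v k[%classic) ->
      \sum_k (v k - u k) < d ->
      \sum_k `|f (v k) - f (u k)| < e.

(* [itv_partition a b s] says that a :: s is strictly increasing from a to b;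
   when a = b the only such s is empty and the condition is vacuous. *)
Definition piecewise_constant (R : realType) (a b : R) (f : R -> R) : Prop :=
  exists2 s : seq R, itv_partition a b s &
    forall k : nat, (k < size s)%N ->
    forall t u : R,
      t \in `[nth b (a :: s) k, nth b (a :: s) k.+1[ ->
      u \in `[nth b (a :: s) k, nth b (a :: s) k.+1[ ->
      f t = f u.

Definition mean (R : realType) (T : R) (f : R -> R) : R :=
  T^-1 * \int[@lebesgue_measure R]_(t in `[0, T]) f t.

(* [routing j i] and [delay j i] concern flow going from link j to link i. *)
Record roadNetwork (R : realType) := RoadNetwork {
  node : finType;
  link : finType;
  tail : link -> node;
  head : link -> node;
  routing : link -> link -> R;
  delay : link -> link -> R;
  no_self_loop : forall i, tail i != head i;
  routing_downstream : forall j i, head j != tail i -> routing j i = 0;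
  delay_ge0 : forall j i, 0 <= delay j i
}.

Section Network.
Variables (R : realType) (G : roadNetwork R).
Implicit Types (i j : link G) (t : R).

Definition row_sum i : R := \sum_j routing i j.

Definition substochastic : Prop :=
  [/\ forall j i, 0 <= routing j i,
      forall i, row_sum i <= 1 &
      exists i, row_sum i < 1].

Definition adjacent : rel (link G) := [rel i j | head i == tail j].

Definition routed : rel (link G) := [rel i j | 0 < routing i j].

Definition connectivity : Prop :=
  (forall i j, connect adjacent i j \/ connect adjacent j i) /\
  (forall i, row_sum i < 1 \/
             exists j, connect routed i j /\ row_sum j < 1).

(* [undelayed j i] is the membership of j in E_i. *)
Definition undelayed j i : bool := (0 < routing j i) && (delay j i == 0).

(* The maximum over an empty set of links is 0. *)
Definition max_delay_from j : R :=
  \big[Num.max/0]_(i | 0 < routing j i) delay j i.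

Definition max_delay : R :=
  \big[Num.max/0]_(p : link G * link G | 0 < routing p.1 p.2) delay p.1 p.2.

Variables lambda c : link G -> R -> R.

Section Dynamics.
Variables x z : link G -> R -> R.

Definition exo_inflow i t : R :=
  lambda i t + \sum_(j | ~~ undelayed j i) routing j i * z j (t - delay j i).

Definition lp_feasible t (v : link G -> R) : Prop :=
  (forall i, v i <= c i t) /\
  (forall i, x i t = 0 ->
     v i <= exo_inflow i t + \sum_(j | undelayed j i) routing j i * v j).

Definition lp_optimal t (eta v : link G -> R) : Prop :=
  lp_feasible t v /\
  forall w, lp_feasible t w -> \sum_i eta i * w i <= \sum_i eta i * v i.

(* A trajectory is a pair of total functions of which only the restrictions
   x i to [0, +oo[ and z j to [- max_delay_from j, +oo[ are meaningful; z j
   restricted to negative times is the initial history.  Nonnegativity of the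
   queues is part of the state space: the dynamics alone does not enforce it,
   since the inflow constraint is only imposed where x i t = 0.  A history is
   only asked to be nonnegative and integrable, so that the L1 distance of
   histories makes sense: the departures of the periodic trajectory need not
   be piecewise constant when the delays and the period are incommensurable. *)
Definition trajectory : Prop :=
  [/\ forall i (t : R), 0 <= t -> 0 <= x i t,
      forall j, (forall t : R, - max_delay_from j <= t < 0 -> 0 <= z j t) /\
        (@lebesgue_measure R).-integrable `[- max_delay_from j, 0[
          (EFin \o z j),
      forall t : R, 0 <= t -> forall eta : link G -> R,
        (forall i, 0 < eta i) -> lp_optimal t eta (z ^~ t),
      forall i (b : R), 0 < b -> absolutely_continuous 0 b (x i) &
      forall i, {ae @lebesgue_measure R, forall t : R, 0 <= t ->
        is_derive t 1 (x i)
          (exo_inflow i t + \sum_(j | undelayed j i) routing j i * z j t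
             - z i t)}].

Definition initially_piecewise_constant : Prop :=
  forall j, (forall t : R, - max_delay <= t < 0 -> 0 <= z j t) /\
            piecewise_constant (- max_delay) 0 (z j).

Definition periodic_trajectory (T : R) : Prop :=
  [/\ trajectory,
      forall i (t : R), 0 <= t -> x i (t + T) = x i t &
      forall j (t : R), - max_delay_from j <= t -> z j (t + T) = z j t].

End Dynamics.

Definition same_trajectory (x z x' z' : link G -> R -> R) : Prop :=
  (forall i (t : R), 0 <= t -> x i t = x' i t) /\
  (forall j (t : R), - max_delay_from j <= t -> z j t = z' j t).

Definition converges (x z x' z' : link G -> R -> R) : Prop :=
  (\sum_i `|x i t - x' i t| @[t --> +oo] --> (0 : R)) /\
  (\sum_i \sum_j routing j i *
     (\int[@lebesgue_measure R]_(s in `[t - delay j i, t]) `|z j s - z' j s|)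
     @[t --> +oo] --> (0 : R)).

End Network.

(* Main.v *)
Require Import Defs.
From HB Require Import structures.
From mathcomp Require Import all_boot all_order all_algebra.
From mathcomp Require Import all_classical all_reals all_analysis.
From mathcomp Require Import measurable_realfun.
From mathcomp Require Import ring lra.
Import Order.TTheory GRing.Theory Num.Theory.
Import numFieldNormedType.Exports.
Local Open Scope classical_set_scope.
Local Open Scope ring_scope.

(** Write [a i] for the total inflow of a link, external and routed, so that
    [a i t = lambda i t + \sum_j R_ji z j (t - delay j i)]. The feasible set of the
    linear program is closed under maxima, so its optimum is its greatest point, for
    every objective: [z i = c i] if [x i > 0], and [z i = min (c i) (a i)] if
    [x i = 0]. Each link is thus a queue served at rate [c i], and
    [x i' = a i - z i] almost everywhere.

    Every link leads to a link that loses flow. Hence there are weights [w > 0] with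
    [\sum_i R_ji w i < w j] for all [j] ([routing_weights]): in weighted sums,
    routing is a contraction, with or without delays.

    Existence. Extend the inputs periodically to the whole line. A queue whose net
    input [f = a - c] has negative mean admits the stationary content
    [x t = sup_(s <= t) \int_s^t f], which solves its equation almost everywhere
    ([queue_derive]). Departures never exceed the capacity, so the stability
    condition bounds the mean inflow of every link, and the map from departures to
    the departures of the stationary queues they feed is defined, and nondecreasing.
    Iterated from 0, it increases to a periodic limit, which is a fixed point at
    every time ([regimeE]).

    Convergence. For two trajectories with departures [z] and [z'], the difference of
    queues satisfies, almost everywhere,
    [ `|x i - x' i|' <= \sum_j R_ji `|z j - z' j| (t - delay j i) - `|z i - z' i| ]
    ([queue_discrepancy]), because the longer queue is served at capacity. Integrate
    and sum with the weights: the integrals of [`|z j - z' j|] from 0 to [b] are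
    bounded uniformly in [b]. So the distance of the histories vanishes, and the
    difference of the queues settles. It cannot settle at a nonzero value: one of the
    two queues would remain positive, and its link would depart at capacity, over a
    whole period, whereas the periodic departures leave a positive capacity unused in
    each period ([regime_spare_capacity]).

    Uniqueness. The queues of a periodic trajectory converge to those of the regime,
    hence are equal to them, and the departures then agree by a maximum principle
    along the delays ([bounded_subsolution0]).

    Queues are only known through their derivatives almost everywhere; the passage to
    integrals is [ac_le_integral], a growth lemma for absolutely continuous
    functions. *)

Set Implicit Arguments.
Unset Strict Implicit.
Unset Printing Implicit Defensive.

(** * Bounded measurable functions and their integrals *)
Section BoundedMeasurable.
Context {R : realType}.
Notation mu := (@lebesgue_measure R).
Implicit Types (f g : R -> R) (a b c t : R).

(** Integrands are total, bounded and Borel on the whole line: integrals over all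
    compact intervals then exist, and delays, which translate the argument,
    create no domain conditions. *)
Definition bmeas f := measurable_fun [set: R] f /\ exists K, forall t, `|f t| <= K.

Definition itv_integral f a b := \int[mu]_(t in `[a, b]) f t.

Lemma bmeas_bound f : bmeas f -> exists2 K, 0 < K & forall t, `|f t| <= K.
Proof.
move=> [_ [K fK]]; exists (K + 1); last by move=> t; rewrite (le_trans (fK t))// lerDl.
by rewrite ltr_wpDl// (le_trans _ (fK 0)).
Qed.

Lemma bmeas_cst r : bmeas (cst r).
Proof. by split; [exact: measurable_cst|exists `|r|]. Qed.

Lemma bmeasD f g : bmeas f -> bmeas g -> bmeas (fun t => f t + g t).
Proof.
move=> [mf [K fK]] [mg [L gL]]; split; first exact: measurable_funD.
by exists (K + L) => t; rewrite (le_trans (ler_normD _ _))// lerD.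
Qed.

Lemma bmeasM f g : bmeas f -> bmeas g -> bmeas (fun t => f t * g t).
Proof.
move=> [mf [K fK]] [mg [L gL]]; split; first exact: measurable_funM.
by exists (K * L) => t; rewrite normrM ler_pM.
Qed.

Lemma bmeasZ r f : bmeas f -> bmeas (fun t => r * f t).
Proof. by move=> bf; exact: (bmeasM (bmeas_cst r)). Qed.

Lemma bmeasN f : bmeas f -> bmeas (fun t => - f t).
Proof.
move=> [mf [K fK]]; split; first exact: measurableT_comp.
by exists K => t; rewrite normrN.
Qed.

Lemma bmeasB f g : bmeas f -> bmeas g -> bmeas (fun t => f t - g t).
Proof. by move=> bf bg; exact: (bmeasD bf (bmeasN bg)). Qed.

Lemma bmeas_norm f : bmeas f -> bmeas (fun t => `|f t|).
Proof.
move=> [mf [K fK]]; split; first exact: measurableT_comp.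
by exists K => t; rewrite normr_id.
Qed.

Lemma bmeas_sum (I : finType) (F : I -> R -> R) :
  (forall i, bmeas (F i)) -> bmeas (fun t => \sum_i F i t).
Proof.
move=> bF; suff : forall s : seq I, bmeas (fun t => \sum_(i <- s) F i t) by exact.
elim=> [|i s IH].
  by rewrite (_ : (fun _ => _) = cst 0); [exact: bmeas_cst|apply/funext => t; rewrite big_nil].
rewrite (_ : (fun _ => _) = (fun t => F i t + \sum_(i <- s) F i t)); first exact: bmeasD.
by apply/funext => t; rewrite big_cons.
Qed.

Lemma bmeas_if (A : set R) f g : measurable A -> bmeas f -> bmeas g ->
  bmeas (fun t => if t \in A then f t else g t).
Proof.
move=> mA [mf [K fK]] [mg [L gL]]; split.
  apply: measurable_fun_ifT => //.
  by apply: (measurable_fun_bool true); rewrite setTI (_ : _ @^-1` _ = A)//;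
    apply/seteqP; split => t /= h; [exact: set_mem|exact: mem_set].
exists (Num.max K L) => t; case: ifP => _.
  by rewrite le_max fK.
by rewrite le_max gL orbT.
Qed.

Lemma bmeas_min f g : bmeas f -> bmeas g -> bmeas (fun t => Num.min (f t) (g t)).
Proof.
move=> [mf [K fK]] [mg [L gL]]; split; first exact: measurable_minr.
by exists (Num.max K L) => t; rewrite /Num.min; case: ifP => _; rewrite le_max ?fK ?gL ?orbT.
Qed.

Lemma bmeas_shift d f : bmeas f -> bmeas (fun t => f (t - d)).
Proof.
move=> [mf [K fK]]; split; last by exists K.
by apply: (measurableT_comp mf); exact: measurable_funB.
Qed.

Lemma bmeas_integrable f a b : bmeas f -> mu.-integrable `[a, b] (EFin \o f).
Proof.
move=> [mf [K fK]]; apply: measurable_bounded_integrable => //=.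
- by rewrite lebesgue_measure_itv/=; case: ifP => // _; rewrite ltry.
- exact: measurable_funS mf.
- by exists K; split; [exact: num_real|move=> M KM t _ /=; rewrite (le_trans (fK t))// ltW].
Qed.

Lemma itv_integral_chain f a b c : bmeas f -> a <= b -> b <= c -> itv_integral f a c =
  itv_integral f a b + itv_integral f b c.
Proof.
move=> bf ab bc; apply/eqP; rewrite addrC -subr_eq; apply/eqP; rewrite /itv_integral.
rewrite (@Rintegral_itvB _ f (BLeft a) (BRight c) b) ?bnd_simp//; last exact: bmeas_integrable.
rewrite Rintegral_itv_obnd_cbnd//.
by apply: integrableS (bmeas_integrable b c bf) => //; apply: subset_itvr; rewrite bnd_simp.
Qed.

Lemma itv_integral_le f g a b : bmeas f -> bmeas g -> (forall t, a <= t <= b -> f t <= g t) ->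
  itv_integral f a b <= itv_integral g a b.
Proof.
move=> bf bg fg; apply: le_Rintegral (bmeas_integrable a b bf) (bmeas_integrable a b bg) _; first by [].
by move=> t /=; rewrite in_itv/=; exact: fg.
Qed.

Lemma itv_integral_eq f g a b : (forall t, a <= t <= b -> f t = g t) ->
  itv_integral f a b = itv_integral g a b.
Proof. by move=> fg; apply: eq_Rintegral => t; rewrite inE/= in_itv/=; exact: fg. Qed.

Lemma itv_integral_ge0 f a b : (forall t, a <= t <= b -> 0 <= f t) -> 0 <= itv_integral f a b.
Proof. by move=> f0; apply: Rintegral_ge0 => t /=; rewrite in_itv/=; exact: f0. Qed.

Lemma itv_integralD f g a b : bmeas f -> bmeas g ->
  itv_integral (fun t => f t + g t) a b = itv_integral f a b + itv_integral g a b.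
Proof. by move=> bf bg; exact: (RintegralD _ (bmeas_integrable a b bf) (bmeas_integrable a b bg)). Qed.

Lemma itv_integralB f g a b : bmeas f -> bmeas g ->
  itv_integral (fun t => f t - g t) a b = itv_integral f a b - itv_integral g a b.
Proof. by move=> bf bg; exact: (RintegralB _ (bmeas_integrable a b bf) (bmeas_integrable a b bg)). Qed.

Lemma itv_integralZ r f a b : bmeas f -> itv_integral (fun t => r * f t) a b =
  r * itv_integral f a b.
Proof. by move=> bf; exact: (RintegralZl _ _ (bmeas_integrable a b bf)). Qed.

Lemma itv_integralN f a b : bmeas f -> itv_integral (fun t => - f t) a b =
  - itv_integral f a b.
Proof.
by move=> bf; rewrite -[RHS]mulN1r -itv_integralZ//; apply: itv_integral_eq => t _; rewrite mulN1r.
Qed.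

Lemma itv_integral_cst r a b : a <= b -> itv_integral (cst r) a b = r * (b - a).
Proof.
move=> ab; rewrite /itv_integral Rintegral_cst//; congr (_ * _).
have /= -> := lebesgue_measure_itv `[a, b]; rewrite lte_fin.
by case: ltP => //= ba; rewrite (@le_anti _ _ a b) ?ab ?ba// subrr.
Qed.

Lemma itv_integral_sum (I : finType) (F : I -> R -> R) a b : (forall i, bmeas (F i)) ->
  itv_integral (fun t => \sum_i F i t) a b = \sum_i itv_integral (F i) a b.
Proof.
move=> bF; suff : forall s : seq I, bmeas (fun t => \sum_(i <- s) F i t) /\
    itv_integral (fun t => \sum_(i <- s) F i t) a b = \sum_(i <- s) itv_integral (F i) a b.
  by move=> /(_ (index_enum I))[].
elim=> [|i s [bs IH]].
  rewrite (_ : (fun _ => _) = cst 0); last by apply/funext => t; rewrite big_nil.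
  split; first exact: bmeas_cst.
  by rewrite big_nil /itv_integral Rintegral_cst// mul0r.
rewrite (_ : (fun _ => _) = (fun t => F i t + \sum_(i <- s) F i t)); last first.
  by apply/funext => t; rewrite big_cons.
by split; [exact: bmeasD|rewrite itv_integralD// IH big_cons].
Qed.

Lemma itv_integral_abs_le f K a b : bmeas f -> (forall t, a <= t <= b -> `|f t| <= K) ->
  a <= b -> `|itv_integral f a b| <= K * (b - a).
Proof.
move=> bf fK ab; rewrite -itv_integral_cst// /itv_integral.
apply: le_trans (le_normr_Rintegral _ (bmeas_integrable a b bf)) _ => //.
exact: (itv_integral_le (bmeas_norm bf) (bmeas_cst K)).
Qed.

Lemma itv_integral_abs f a b : bmeas f -> `|itv_integral f a b| <=
  itv_integral (fun t => `|f t|) a b.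
Proof. by move=> bf; exact: (le_normr_Rintegral _ (bmeas_integrable a b bf)). Qed.

Lemma itv_integral_point f a : itv_integral f a a = 0.
Proof. by rewrite /itv_integral set_itv1 Rintegral_set1. Qed.

Lemma itv_integral_subitv f a b c d : bmeas f -> (forall t, a <= t <= d -> 0 <= f t) ->
  a <= b -> b <= c -> c <= d -> itv_integral f b c <= itv_integral f a d.
Proof.
move=> bf f0 ab bc cd; rewrite (itv_integral_chain bf ab (le_trans bc cd)) (itv_integral_chain bf bc cd).
rewrite addrCA -[leLHS]addr0 lerD2l addr_ge0//; apply: itv_integral_ge0 => t /andP[h1 h2]; apply: f0.
  by rewrite h1 (le_trans h2)// (le_trans bc).
by rewrite h2 (le_trans ab)// (le_trans bc).
Qed.

Lemma itv_integral_cvg (F : nat -> R -> R) f a b K : (forall n, bmeas (F n)) -> bmeas f ->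
  (forall n t, `|F n t| <= K) -> (forall t, F n t @[n --> \oo] --> f t) ->
  itv_integral (F n) a b @[n --> \oo] --> itv_integral f a b.
Proof.
move=> bF bf FK Ff.
have mI : measurable (`[a, b]%classic : set R) by [].
have [] := @dominated_convergence _ _ _ mu `[a, b]%classic mI (fun n => EFin \o F n) (EFin \o f)
  (EFin \o cst K).
- by move=> n; apply/measurable_EFinP; apply: measurable_funS (bF n).1.
- by apply/measurable_EFinP; apply: measurable_funS bf.1.
- by apply/aeW => t _; apply/fine_cvgP; split; [exact: nearW|exact: Ff].
- exact: (bmeas_integrable _ _ (bmeas_cst K)).
- by apply/aeW => t n _ /=; rewrite lee_fin.
move=> _ _ h; apply: fine_cvg; rewrite fineK//.
by apply: integrable_fin_num => //; exact: bmeas_integrable.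
Qed.

End BoundedMeasurable.

(** * Translation and differentiation of integrals *)
Section Calculus.
Context {R : realType}.
Notation mu := (@lebesgue_measure R).
Implicit Types (f g h : R -> R) (a b c d t : R).

(** Translation preserves the length of the generating intervals, and Lebesgue
    measure is determined by it. *)
Lemma lebesgue_measure_shift d (A : set (measurableTypeR R)) : measurable A ->
  mu A = mu ((fun t => t - d) @^-1` A).
Proof.
have mphi : measurable_fun setT (fun t : measurableTypeR R => t - d : measurableTypeR R).
  exact: measurable_funB.
move=> mA; rewrite (@lebesgue_measure_unique R (pushforward mu (fun t : measurableTypeR R => t - d : measurableTypeR R)))//.
move=> X /ocitvP[->|[[u v] /= uv ->]].
  by rewrite !measure0.
rewrite /pushforward (_ : _ @^-1` _ = `]u + d, v + d]%classic).
  by rewrite !lebesgue_measure_itv/= !lte_fin ltrD2r; case: ifP => // _; rewrite -!EFinD; congr EFin; ring.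
by apply/seteqP; split => t /=; rewrite !in_itv/= ltrBrDr lerBlDr.
Qed.

Lemma itv_integral_shift f d a b : bmeas f -> itv_integral (fun t => f (t - d)) a b =
  itv_integral f (a - d) (b - d).
Proof.
move=> bf; rewrite /itv_integral /Rintegral; congr fine.
have mphi : measurable_fun setT (fun t : measurableTypeR R => t - d : measurableTypeR R).
  exact: measurable_funB.
have E : (fun t => t - d) @^-1` `[a - d, b - d]%classic = `[a, b]%classic.
  by apply/seteqP; split => t /=; rewrite !in_itv/= !lerD2r.
have := @integral_pushforward _ _ _ _ R _ mphi mu `[a - d, b - d]%classic (EFin \o f).
rewrite E => <-//.
- by apply: eq_measure_integral => A mA _; rewrite [RHS](lebesgue_measure_shift d mA).
- by apply/measurable_EFinP; exact: bf.1.
- exact: (bmeas_integrable a b (bmeas_shift d bf)).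
Qed.

(** Derivatives as first-order estimates, multiplied out so that no quotient of
    increments remains. *)
Lemma is_deriveP f t l : is_derive t 1 f l <->
  (forall e, 0 < e -> exists2 r, 0 < r & forall v, `|v - t| < r ->
     `|f v - f t - l * (v - t)| <= e * `|v - t|).
Proof.
have key : (h^-1 *: ((f \o shift t) (h *: (1 : R)) - f t)) @[h --> (0:R)^'] --> (l : R) <->
  (forall e, 0 < e -> exists2 r, 0 < r & forall v, `|v - t| < r ->
     `|f v - f t - l * (v - t)| <= e * `|v - t|).
  split.
    move=> /cvgrPdist_le + e e0 => /(_ e e0)[r /= r0 rP]; exists r => // v vr.
    have [->|vt] := eqVneq v t; first by rewrite !subrr mulr0 subrr !normr0 mulr0.
    have vt0 : v - t != 0 by rewrite subr_eq0.
    have := rP (v - t); rewrite /= sub0r normrN => /(_ vr vt0).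
    rewrite /shift /= [_ *: 1]mulr1 subrK /GRing.scale/=.
    rewrite -(@ler_pM2r _ `|v - t|) ?normr_gt0// -normrM => H.
    apply: le_trans H.
    rewrite (_ : f v - f t - l * (v - t) = - ((l - (v - t)^-1 * (f v - f t)) * (v - t))); last by field.
    by rewrite normrN.
  move=> H; apply/cvgrPdist_le => e e0; have [r r0 rP] := H e e0.
  exists r => // h /=; rewrite sub0r normrN => hr h0.
  have := rP (h + t); rewrite addrK => /(_ hr).
  rewrite /shift /= [_ *: 1]mulr1 /GRing.scale/= => H1.
  rewrite -(@ler_pM2r _ `|h|) ?normr_gt0// -normrM (le_trans _ H1)//.
  rewrite (_ : (l - h^-1 * (f (h + t) - f t)) * h = - (f (h + t) - f t - l * h)) ?normrN//.
  by field.
rewrite -key; split.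
  move=> [df fl]; have := derivableP df. 
  move: df; rewrite /derivable => /cvg_ex[l' l'P].
  by rewrite -fl /derive (cvg_lim _ l'P)//.
move=> H; split; first by apply/cvg_ex; exists l.
by rewrite /derive; apply: cvg_lim.
Qed.

(** Lebesgue's differentiation theorem, in the form of the first fundamental
    theorem of calculus. *)
Lemma itv_integral_ae_derive f a : bmeas f ->
  {ae mu, forall t, a < t -> is_derive t 1 (fun u => itv_integral f a u) (f t)}.
Proof.
move=> bf; have lf : locally_integrable setT f.
  split; [exact: bf.1|exact: openT|move=> K _ cK].
  have mK : measurable K by exact: compact_measurable.
  have [M M0 fM] := bmeas_bound bf.
  apply: (@le_lt_trans _ _ (\int[mu]_(x in K) (cst M%:E x))%E).
    apply: ge0_le_integral => //=.
    - by apply/measurable_EFinP; apply: measurableT_comp => //; apply: measurable_funS bf.1.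
    - by move=> x _; rewrite lee_fin.
  rewrite integral_cst//; apply: lte_mul_pinfty => //; first by rewrite lee_fin ltW.
  exact: compact_finite_measure.
have := @FTC1 R f (BLeft a) (fun y => bmeas_integrable a y bf) lf.
apply: filterS; first exact: (ae_filter_ringOfSetsType mu).
move=> t /= H at_; have [|df fE] := H; first by rewrite lte_fin.
have fE' : 'D_1 (fun u => itv_integral f a u) t = f t by rewrite -derive1E; exact: fE.
exact: (DeriveDef df fE').
Qed.

End Calculus.

(** * Increments of absolutely continuous functions *)
Section AbsoluteContinuity.
Context {R : realType}.
Notation mu := (@lebesgue_measure R).
Implicit Types (f g h : R -> R) (a b c d t u v w : R).

(** The supremum of the right ends that are reached from [a] is itself reached, and
    must be [b]: compactness of a segment, in the form of Cousin's lemma. *)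
Lemma cousin (P : R -> R -> Prop) a b : a <= b ->
  (forall u w v, u <= w -> w <= v -> P u w -> P w v -> P u v) ->
  (forall t, a <= t <= b -> exists2 r, 0 < r & forall u v, a <= u -> u <= t -> t <= v ->
     v <= b -> v - u < r -> P u v) ->
  P a b.
Proof.
move=> ab Padd Ploc; pose S := [set v | a <= v <= b /\ P a v].
have Sa : S a.
  split; first by rewrite lexx ab.
  have [|r r0] := Ploc a; first by rewrite lexx ab.
  by apply=> //; rewrite subrr.
have ubS : ubound S b by move=> v [/andP[_ ->]].
have hS : has_sup S by split; [exists a|exists b].
set s := sup S.
have sb : s <= b by apply: ge_sup => //; exists a.
have as_ : a <= s by apply: sup_upper_bound.
have [|r r0 rP] := Ploc s; first by rewrite as_ sb.
have r2 : 0 < r / 2 by lra.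
have [v Sv sv] := sup_adherent r2 hS.
have vs : v <= s by apply: sup_upper_bound.
case: Sv => /andP[av vb] Pav.
set s' := Num.min b (s + r / 3).
have ss' : s <= s' by rewrite le_min sb; lra.
have s'b : s' <= b by rewrite ge_min lexx.
have s'r : s' <= s + r / 3 by rewrite ge_min lexx orbT.
have Pas' : P a s'.
  apply: (Padd _ v) => //; first lra.
  by apply: rP => //; move: sv; rewrite -/s; lra.
have : s' <= s by apply: sup_upper_bound => //; split=> //; rewrite s'b (le_trans as_).
rewrite ge_min => /orP[bs|]; last lra.
suff -> : b = s' by [].
by apply/eqP; rewrite eq_le s'b andbT (le_trans bs).
Qed.

(** Lists of intervals rather than families indexed by ordinals, because the
    partitions of adjacent segments are to be concatenated. *)
Fixpoint itv_chain u (s : seq (R * R)) v : bool :=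
  if s is p :: s' then [&& u <= p.1, p.1 <= p.2 & itv_chain p.2 s' v] else u <= v.

Lemma itv_chain_le u s v : itv_chain u s v -> u <= v.
Proof.
elim: s u => //= p s IH u /and3P[up pp /IH]; exact: le_trans (le_trans up pp).
Qed.

Lemma itv_chain_cat u s w s' v : itv_chain u s w -> itv_chain w s' v ->
  itv_chain u (s ++ s') v.
Proof.
elim: s u => /= [|p s IH] u.
  by case: s' => /= [|p s'] uw => [|/and3P[wp ->]]; [exact: le_trans|rewrite (le_trans uw)].
by move=> /and3P[-> -> /IH]; exact.
Qed.

Lemma itv_chain_nth u s v k : itv_chain u s v -> (k < size s)%N ->
  [/\ u <= (nth (0, 0) s k).1, (nth (0, 0) s k).1 <= (nth (0, 0) s k).2
    & (nth (0, 0) s k).2 <= v].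
Proof.
elim: s u k => //= p s IH u [|k] /and3P[up pp ps] /=; first by split=> //; exact: itv_chain_le ps.
by rewrite ltnS => /(IH _ _ ps)[h1 h2 h3]; split=> //; rewrite (le_trans up)// (le_trans pp).
Qed.

Lemma itv_chain_lt u s v k l : itv_chain u s v -> (k < l < size s)%N ->
  (nth (0, 0) s k).2 <= (nth (0, 0) s l).1.
Proof.
elim: s u k l => [|p s IH] u k l /=; first by rewrite ltn0 andbF.
case: l => [|l]; first by rewrite ltn0.
case: k => [|k] /and3P[up pp ps] /andP[kl ls] /=.
  by case: (itv_chain_nth ps ls).
by apply: (IH p.2 k l ps); apply/andP; split.
Qed.

(** Cover the null set of bad points by an open set [U] of small measure. By [cousin]
    the segment splits into intervals around good points, over which the function
    increases by at most [e] times their length, and intervals inside [U], whose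
    total length is so small that absolute continuity bounds the sum of the
    increments. *)
Lemma ac_le f a b : a <= b -> absolutely_continuous a b f ->
  {ae mu, forall t, a <= t <= b -> forall e, 0 < e -> exists2 r, 0 < r &
    forall u v, a <= u -> u <= t -> t <= v -> v <= b -> v - u < r ->
      f v - f u <= e * (v - u)} ->
  f b <= f a.
Proof.
move=> ab acf [N [mN N0 HN]].
apply/ler_addgt0Pl => e0 e00.
have [e [e_gt0 ee0]] : exists e, 0 < e /\ e * (b - a) + e <= e0.
  exists (e0 / (b - a + 1)); have ba1 : 0 < b - a + 1 by rewrite ltr_wpDl// subr_ge0.
  split; first by rewrite divr_gt0.
  by rewrite -[X in _ + X]mulr1 -mulrDr divfK// gt_eqF.
have [dl dl0 dlP] := acf e e_gt0.
have [|U [oU NU muUN]] := lebesgue_regularity_outer mN _ dl0; first by rewrite [X in (X < _)%E]N0 ltry.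
have mU : measurable U by exact: open_measurable.
have muU : (mu U < dl%:E)%E.
  rewrite -(setDUK NU) measureU//; last 2 first.
  - exact: measurableD.
  - by rewrite setIDA setIC -setIDA setDv setI0.
  by rewrite [X in (X + _)%E]N0 add0e.
pose g := \1_U : R -> R.
have bg : bmeas g.
  split; first exact: measurable_indic.
  by exists 1 => t; rewrite /g indicE; case: (_ \in _); rewrite ?normr1 ?normr0.
have gdl : itv_integral g a b < dl.
  rewrite /itv_integral /Rintegral integral_indic//.
  have UI : (mu (U `&` `[a, b]) <= mu U)%E by apply: le_measure; rewrite ?inE//; exact: measurableI.
  rewrite -lte_fin fineK; first exact: le_lt_trans muU.
  by rewrite ge0_fin_numE// (le_lt_trans UI)// (lt_trans muU) ?ltry.
(* [s] lists the intervals of a partition of [u, v] that are tagged in [U];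
   comparing their lengths with an integral makes the property additive. *)
pose P u v := exists s, [/\ itv_chain u s v, \sum_(p <- s) (p.2 - p.1) <= itv_integral g u v &
  f v - f u <= e * (v - u) + \sum_(p <- s) `|f p.2 - f p.1|].
have [|t /andP[at_ tb]|s [cs sg fs]] := @cousin P a b ab.
- move=> u w v uw wv [s [cs sg fs]] [s' [cs' sg' fs']]; exists (s ++ s').
  rewrite !big_cat/= (itv_integral_chain bg uw wv); split; [exact: itv_chain_cat cs'|exact: lerD|].
  by have := lerD fs fs'; lra.
- have [tU|tU] := pselect (U t).
    have /nbhs_ballP[r /= r0 rU] := open_nbhs_nbhs (conj oU tU).
    exists r => // u v au ut tv vb vur; exists [:: (u, v)].
    rewrite !big_cons !big_nil !addr0 /= !lexx (le_trans ut tv); split=> //.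
      rewrite (@itv_integral_eq _ g (cst 1)) ?itv_integral_cst ?mul1r// ?(le_trans ut tv)//.
      move=> w /andP[uw wv]; rewrite /g indicE mem_set//; apply: rU.
      by rewrite /ball/= ltr_norml; lra.
    have := ler_norm (f v - f u); have : 0 <= e * (v - u); last lra.
    by apply: mulr_ge0; [exact: ltW|rewrite subr_ge0 (le_trans ut tv)].
  have [|r r0 rP] := contrapT (contra_not (@HN t) (contra_not (@NU t) tU)) _ e e_gt0.
    by rewrite at_ tb.
  exists r => // u v au ut tv vb vur; exists [::]; rewrite !big_nil /= (le_trans ut tv); split=> //.
    by apply: itv_integral_ge0 => w _; rewrite /g indicE.
  by rewrite addr0; exact: rP.
have := dlP (size s) (fun k => (nth (0, 0) s k).1) (fun k => (nth (0, 0) s k).2).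
rewrite -(big_mkord xpredT (fun k => (nth (0, 0) s k).2 - (nth (0, 0) s k).1)).
rewrite -(big_mkord xpredT (fun k => `|f (nth (0, 0) s k).2 - f (nth (0, 0) s k).1|)).
rewrite -(big_nth (0, 0) xpredT (fun p => p.2 - p.1)).
rewrite -(big_nth (0, 0) xpredT (fun p => `|f p.2 - f p.1|)).
move=> H; have : \sum_(p <- s) `|f p.2 - f p.1| < e; last lra.
apply: H; last lra.
  by move=> k; have [] := itv_chain_nth cs (ltn_ord k).
move=> i j _ _ [w [/=]]; rewrite !in_itv/= => /andP[iw wi] /andP[jw wj].
apply/val_inj; case: (ltngtP i j) => // ij; exfalso.
  have /(itv_chain_lt cs) : (i < j < size s)%N by rewrite ij ltn_ord.
  lra.
have /(itv_chain_lt cs) : (j < i < size s)%N by rewrite ij ltn_ord.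
lra.
Qed.

Lemma ac_lipschitz f K a b : (forall u v, a <= u -> u <= v -> v <= b ->
    `|f v - f u| <= K * (v - u)) -> absolutely_continuous a b f.
Proof.
move=> fK e e0; have K0 : 0 < `|K| + 1 by rewrite ltr_wpDl.
exists (e / (`|K| + 1)); first exact: divr_gt0.
move=> n u v uv _; rewrite ltr_pdivlMr// => uve.
apply: le_lt_trans uve; rewrite mulr_suml; apply: ler_sum => k _.
have [au [ukvk vb]] := uv k; apply: le_trans (fK _ _ au ukvk vb) _.
by rewrite mulrC ler_wpM2l ?subr_ge0// (le_trans (ler_norm _))// lerDl.
Qed.

Lemma acB f g a b : absolutely_continuous a b f -> absolutely_continuous a b g ->
  absolutely_continuous a b (fun t => f t - g t).
Proof.
move=> acf acg e e0; have e2 : 0 < e / 2 by lra.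
have [d d0 dP] := acf _ e2; have [d' d'0 d'P] := acg _ e2.
exists (Num.min d d'); first by rewrite lt_min d0.
move=> n u v uv tuv; rewrite lt_min => /andP[ud ud'].
have := ltrD (dP _ _ _ uv tuv ud) (d'P _ _ _ uv tuv ud').
rewrite -big_split/= -splitr; apply: le_lt_trans; apply: ler_sum => k _.
by rewrite opprD addrACA -opprD; apply: ler_normB.
Qed.

Lemma ac_norm f a b : absolutely_continuous a b f ->
  absolutely_continuous a b (fun t => `|f t|).
Proof.
move=> acf e e0; have [d d0 dP] := acf _ e0; exists d => // n u v uv tuv uvd.
by apply: le_lt_trans (dP _ _ _ uv tuv uvd); apply: ler_sum => k _; exact: ler_dist_dist.
Qed.

(** Integrated form of [ac_le]. Only an upper bound of the increments over
    intervals around almost every point is asked for, so it applies to functions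
    such as [`|y|], which need not be differentiable at the zeros of [y]. *)
Lemma ac_le_integral f h a b : a <= b -> absolutely_continuous a b f -> bmeas h ->
  {ae mu, forall t, a <= t <= b -> forall e, 0 < e -> exists2 r, 0 < r &
    forall u v, a <= u -> u <= t -> t <= v -> v <= b -> v - u < r ->
      f v - f u <= (h t + e) * (v - u)} ->
  f b - f a <= itv_integral h a b.
Proof.
move=> ab acf bh Hf; have [K K0 hK] := bmeas_bound bh.
pose H u := itv_integral h (a - 1) u.
have HB u v : a <= u -> u <= v -> H v - H u = itv_integral h u v.
  by move=> au uv; rewrite /H (@itv_integral_chain _ h (a - 1) u v)//; [rewrite addrC addKr|lra].
rewrite -HB//.
suff : f b - H b <= f a - H a by lra.
apply: (@ac_le (fun t => f t - H t)) => //.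
  apply: acB => //; apply: (@ac_lipschitz _ K) => u v au uv vb.
  by rewrite HB//; apply: itv_integral_abs_le.
apply: filterS2 Hf (itv_integral_ae_derive (a - 1) bh); first exact: (ae_filter_ringOfSetsType mu).
move=> t Hf Hd tab e e0; have e2 : 0 < e / 2 by lra.
have [r r0 rP] := Hf tab _ e2.
have at1 : a - 1 < t by lra.
have [r' r'0 r'P] := (is_deriveP _ _ _).1 (Hd at1) _ e2.
exists (Num.min r r'); first by rewrite lt_min r0.
move=> u v au ut tv vb; rewrite lt_min => /andP[vur vur'].
have := rP u v au ut tv vb vur.
have /r'P : `|v - t| < r' by rewrite ger0_norm ?subr_ge0//; lra.
have /r'P : `|u - t| < r' by rewrite distrC ger0_norm ?subr_ge0//; lra.
have -> : `|v - t| = v - t by rewrite ger0_norm// subr_ge0.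
have -> : `|u - t| = t - u by rewrite distrC ger0_norm// subr_ge0.
rewrite -/(H u) -/(H v) -/(H t) !ler_norml.
move=> /andP[h1 h2] /andP[h3 h4] h5; lra.
Qed.

End AbsoluteContinuity.

(* From here on, integrals are used through the properties above only. *)
Opaque itv_integral.

Section DerivativesAE.
Context {R : realType}.
Notation mu := (@lebesgue_measure R).
Implicit Types (f g h y k m : R -> R) (a b c d t u v w : R).

Lemma is_derive_straddle f t l e : is_derive t 1 f l -> 0 < e ->
  exists2 r, 0 < r & forall u v, u <= t -> t <= v -> v - u < r ->
    `|f v - f u - l * (v - u)| <= e * (v - u).
Proof.
move=> /is_deriveP H /H[r r0 rP]; exists r => // u v ut tv uvr.
have av : `|v - t| = v - t by rewrite ger0_norm// subr_ge0.
have au : `|u - t| = t - u by rewrite distrC ger0_norm// subr_ge0.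
have := rP v; have := rP u; rewrite av au => /(_ ltac:(lra)) + /(_ ltac:(lra)).
rewrite !ler_norml => /andP[h1 h2] /andP[h3 h4]; apply/andP; split; lra.
Qed.

Lemma ac_integral_eq f h a b : a <= b -> absolutely_continuous a b f -> bmeas h ->
  {ae mu, forall t, a <= t <= b -> is_derive t 1 f (h t)} ->
  f b - f a = itv_integral h a b.
Proof.
move=> ab acf bh Hf; apply/eqP; rewrite eq_le; apply/andP; split.
  apply: ac_le_integral => //; apply: filterS Hf; first exact: (ae_filter_ringOfSetsType mu).
  move=> t Ht tab e e0; have [r r0 rP] := is_derive_straddle (Ht tab) e0.
  exists r => // u v _ ut tv _ uvr; have := rP _ _ ut tv uvr.
  rewrite ler_norml => /andP[h1 h2]; lra.
suff : - f b - - f a <= itv_integral (fun t => - h t) a b by rewrite itv_integralN//; lra.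
apply: (@ac_le_integral _ (fun t => - f t)) => //; last 2 first.
- exact: bmeasN.
- apply: filterS Hf; first exact: (ae_filter_ringOfSetsType mu).
  move=> t Ht tab e e0; have [r r0 rP] := is_derive_straddle (Ht tab) e0.
  exists r => // u v _ ut tv _ uvr; have := rP _ _ ut tv uvr.
  rewrite ler_norml => /andP[h1 h2]; lra.
move=> e e0; have [d d0 dP] := acf e e0; exists d => // n u v uv tuv uvd.
apply: le_lt_trans (dP n u v uv tuv uvd); apply: ler_sum => i _.
by rewrite -opprD normrN.
Qed.

(** Where [y] vanishes, an increment of [`|y|] over an interval around the point
    is at most the final value of [`|y|], which [`|k|] controls; elsewhere [`|y|]
    coincides with [y] or [- y] nearby. *)
Lemma ac_norm_le_integral y k m a b : a <= b -> absolutely_continuous a b y -> bmeas m ->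
  {ae mu, forall t, a <= t <= b -> is_derive t 1 y (k t) /\
    [/\ y t = 0 -> `|k t| <= m t, 0 < y t -> k t <= m t & y t < 0 -> - k t <= m t]} ->
  `|y b| - `|y a| <= itv_integral m a b.
Proof.
move=> ab acy bm Hy; apply: (@ac_le_integral _ (fun t => `|y t|)) => //; first exact: ac_norm.
apply: filterS Hy; first exact: (ae_filter_ringOfSetsType mu).
move=> t Ht tab e e0; have {Ht} [dy [m0 mp mn]] := Ht tab.
have [r r0 rP] := is_derive_straddle dy e0.
have sgn : exists2 r, 0 < r & forall u v, u <= t -> t <= v -> v - u < r ->
    (0 < y t -> 0 < y u /\ 0 < y v) /\ (y t < 0 -> y u < 0 /\ y v < 0).
  have [r1 r10 r1P] := is_derive_straddle dy ltr01.
  pose K := 1 + `|k t|; have K0 : 0 < K by rewrite ltr_pwDl.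
  have yK u v : u <= t -> t <= v -> v - u < r1 -> `|y v - y u| <= K * (v - u).
    move=> ut tv uvr; have H := r1P _ _ ut tv uvr.
    have -> : y v - y u = (y v - y u - k t * (v - u)) + k t * (v - u) by rewrite subrK.
    apply: le_trans (ler_normD _ _) _; rewrite normrM (@ger0_norm _ (v - u)).
      rewrite /K mulrDl; apply: lerD => //.
    by rewrite subr_ge0 (le_trans ut).
  have [yt|yt] := eqVneq (y t) 0.
    exists 1; first exact: ltr01.
    by move=> u v _ _ _; rewrite yt ltxx; split.
  have d0 : 0 < `|y t| / K by rewrite divr_gt0 ?normr_gt0.
  exists (Num.min r1 (`|y t| / K)); first by rewrite lt_min r10.
  move=> u v ut tv; rewrite lt_min => /andP[uvr].
  rewrite ltr_pdivlMr// mulrC => uvy.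
  have h1 : `|y v - y t| <= K * (v - t) by apply: yK => //; lra.
  have h2 : `|y t - y u| <= K * (t - u) by apply: yK => //; lra.
  have h3 : K * (v - t) <= K * (v - u) by apply: ler_wpM2l; [exact: ltW|lra].
  have h4 : K * (t - u) <= K * (v - u) by apply: ler_wpM2l; [exact: ltW|lra].
  move: h1 h2; rewrite !ler_norml => /andP[h1 h1'] /andP[h2 h2'].
  split=> yt'; move: uvy; [rewrite gtr0_norm|rewrite ltr0_norm] => //; split; lra.
have {sgn} [r1 r10 r1P] := sgn.
exists (Num.min r r1); first by rewrite lt_min r0.
move=> u v au ut tv vb; rewrite lt_min => /andP[uvr uvr1].
have [sp sn] := r1P _ _ ut tv uvr1.
have uv : 0 <= v - u by lra.
case: (ltgtP (y t) 0) => [yt|yt|yt].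
- have [yu yv] := sn yt; rewrite !ltr0_norm//.
  have := rP _ _ ut tv uvr; rewrite ler_norml => /andP[h1 h2].
  have : - k t * (v - u) <= m t * (v - u) by rewrite ler_wpM2r// mn.
  lra.
- have [yu yv] := sp yt; rewrite !gtr0_norm//.
  have := rP _ _ ut tv uvr; rewrite ler_norml => /andP[h1 h2].
  have : k t * (v - u) <= m t * (v - u) by rewrite ler_wpM2r// mp.
  lra.
- have := rP t v; rewrite lexx yt subr0 => /(_ isT tv ltac:(lra)) H.
  have h1 : `|y v| <= (`|k t| + e) * (v - t).
    have -> : y v = (y v - k t * (v - t)) + k t * (v - t) by rewrite subrK.
    apply: le_trans (ler_normD _ _) _; rewrite normrM (@ger0_norm _ (v - t)) ?subr_ge0//.
    by rewrite mulrDl addrC lerD2l.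
  have h2 : (`|k t| + e) * (v - t) <= (m t + e) * (v - u).
    apply: ler_pM; [|by rewrite subr_ge0|by rewrite lerD2r m0|by lra].
    by rewrite addr_ge0 ?normr_ge0 ?ltW.
  have := normr_ge0 (y u); lra.
Qed.

End DerivativesAE.

(** * The stationary queue *)
Section Queue.
Context {R : realType}.
Notation mu := (@lebesgue_measure R).
Implicit Types (f : R -> R) (a b s t u v w T : R).

(** Reich's formula: the content at time [t] of a buffer with net input rate [f]
    that was empty in the distant past. The best [s] is the last time at which the
    buffer was empty. *)
Definition queue f t := sup [set itv_integral f s t | s in [set s | s <= t]].

Variables (f : R -> R) (T : R).
Hypotheses (bf : bmeas f) (T0 : 0 < T) (fT : forall t, itv_integral f t (t + T) <= 0).

Lemma itv_integral_periods_le0 n t : itv_integral f (t - n%:R * T) t <= 0.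
Proof.
elim: n t => [|n IH] t; first by rewrite mul0r subr0 itv_integral_point.
rewrite (@itv_integral_chain _ f _ (t - T))//; last 2 first.
- by rewrite lerD2l lerN2 -natr1 mulrDl mul1r lerDr mulr_ge0 ?ler0n ?ltW.
- by rewrite gerBl ltW.
have := fT (t - T); rewrite subrK => h1.
have := IH (t - T); rewrite -addrA -opprD (_ : T + n%:R * T = n.+1%:R * T); first lra.
by rewrite -natr1; ring.
Qed.

(** Going back by whole periods only decreases the integral, so the supremum is
    controlled by starting times within one period. *)
Lemma queue_has_sup t : has_sup [set itv_integral f s t | s in [set s | s <= t]].
Proof.
split; first by exists (itv_integral f t t), t => //=.
have [K K0 fK] := bmeas_bound bf.
exists (K * T) => _ [s /= st <-].
pose n := Num.truncn ((t - s) / T).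
have q0 : 0 <= (t - s) / T by rewrite divr_ge0 ?subr_ge0// ltW.
have [n1 n2] : n%:R * T <= t - s /\ t - s < n.+1%:R * T.
  have /andP[] := truncn_itv q0.
  by rewrite -/n ler_pdivlMr// ltr_pdivrMr.
rewrite (@itv_integral_chain _ f s (s + n%:R * T) t)//; last 2 first.
- by rewrite lerDl mulr_ge0// ltW.
- lra.
have h1 : itv_integral f s (s + n%:R * T) <= 0.
  by have := itv_integral_periods_le0 n (s + n%:R * T); rewrite addrK.
have h2 : itv_integral f (s + n%:R * T) t <= K * (t - (s + n%:R * T)).
  apply: le_trans (ler_norm _) _; apply: itv_integral_abs_le => //; lra.
have h3 : K * (t - (s + n%:R * T)) <= K * T.
  by apply: ler_wpM2l; [exact: ltW|move: n2; rewrite -natr1; lra].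
lra.
Qed.

Lemma queue_ge_integral s t : s <= t -> itv_integral f s t <= queue f t.
Proof.
move=> st; apply: sup_upper_bound; [exact: queue_has_sup|by exists s].
Qed.

Lemma queue_le t M : (forall s, s <= t -> itv_integral f s t <= M) -> queue f t <= M.
Proof.
move=> H; apply: ge_sup => [|_ [s /= st <-]]; last exact: H.
by have [] := queue_has_sup t.
Qed.

Lemma queue_ge0 t : 0 <= queue f t.
Proof. by rewrite -(itv_integral_point f t); exact: queue_ge_integral. Qed.

Lemma queue_ge_add u v : u <= v -> queue f u + itv_integral f u v <= queue f v.
Proof.
move=> uv; rewrite -lerBrDr; apply: queue_le => s su.
by rewrite lerBrDr -itv_integral_chain// queue_ge_integral// (le_trans su).
Qed.

Lemma queue_le_add u v M : u <= v -> queue f u + itv_integral f u v <= M ->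
  (forall s, u <= s -> s <= v -> itv_integral f s v <= M) -> queue f v <= M.
Proof.
move=> uv h1 h2; apply: queue_le => s sv; have [su|/ltW us] := leP s u; last exact: h2.
by rewrite (itv_integral_chain bf su uv) (le_trans _ h1)// lerD2r queue_ge_integral.
Qed.

Lemma queue_periodic : (forall t, f (t + T) = f t) -> forall t, queue f (t + T) = queue f t.
Proof.
move=> fp; have sh s t : itv_integral f (s + T) (t + T) = itv_integral f s t.
  by rewrite -[in LHS](opprK T) -itv_integral_shift//; apply: itv_integral_eq => w _; rewrite opprK fp.
move=> t; rewrite /queue; congr (sup _); apply/seteqP; split => _ [s /= st <-].
  by exists (s - T) => /=; [lra|rewrite -(sh (s - T)) subrK].
by exists (s + T) => /=; [lra|rewrite sh].
Qed.

(* From here on only the inequalities above are used. *)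
Opaque queue.

Lemma queue_lipschitz : exists2 K, 0 < K & forall u v, `|queue f v - queue f u| <=
  K * `|v - u|.
Proof.
have [K K0 fK] := bmeas_bound bf; exists K => //.
have main u v : u <= v -> `|queue f v - queue f u| <= K * `|v - u|.
  move=> uv; have vu : 0 <= v - u by rewrite subr_ge0.
  rewrite (ger0_norm vu) ler_norml.
  have /ler_normlP[h1 h2] := itv_integral_abs_le bf (fun t _ => fK t) uv.
  have h3 := queue_ge_add uv; apply/andP; split; first lra.
  rewrite lerBlDr; apply: (@queue_le_add u) => //; first lra.
  move=> s us sv; apply: le_trans (ler_norm _) _.
  apply: le_trans (itv_integral_abs_le bf (fun t _ => fK t) sv) _.
  rewrite -[leLHS]addr0 lerD ?queue_ge0//; apply: ler_wpM2l; [exact: ltW|lra].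
move=> u v; have [/main//|/ltW/main H] := leP u v.
by rewrite -[leLHS]normrN -[X in K * X]normrN !opprB; exact: H.
Qed.

Lemma open_queue_gt0 : open [set t | 0 < queue f t].
Proof.
have [K K0 KP] := queue_lipschitz.
rewrite openE => t /= xt; have d0 : 0 < queue f t / K by rewrite divr_gt0.
apply/nbhs_ballP; exists (queue f t / K); first exact: d0.
move=> v; rewrite /ball /= => tv.
have tv' : K * `|t - v| < queue f t by rewrite mulrC -ltr_pdivlMr.
by have /ler_normlP[_ H] := KP v t; lra.
Qed.

(** Near a time where the queue is positive, the starting times close to [t]
    contribute too little to the supremum: the earlier ones decide, and the queue
    just accumulates [f]. *)
Lemma queue_busy t : 0 < queue f t -> exists2 r, 0 < r & forall u v, `|u - t| < r ->
  `|v - t| < r -> u <= v -> queue f v = queue f u + itv_integral f u v.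
Proof.
move=> xt; have [K K0 KP] := queue_lipschitz; have [L L0 fL] := bmeas_bound bf.
(* within [r] of [t] the queue stays above the integrals of [f] over subintervals *)
pose r := queue f t / (4%:R * (K + L)).
have KL0 : 0 < K + L by lra.
have r0 : 0 < r by rewrite divr_gt0// mulr_gt0.
have rE : r * K + r * L = queue f t / 4%:R by rewrite /r; field; rewrite gt_eqF.
have rK : 0 < r * K by rewrite mulr_gt0.
have rL : 0 < r * L by rewrite mulr_gt0.
exists r => // u v ur vr uv; apply/eqP; rewrite eq_le queue_ge_add// andbT.
pose M := Num.max (queue f u + itv_integral f u v) (L * (v - u)).
have : queue f v <= M.
  apply: (queue_le_add uv); first by rewrite le_max lexx.
  move=> s us sv; rewrite le_max; apply/orP; right.
  apply: le_trans (ler_norm _) _; apply: le_trans (itv_integral_abs_le bf (fun t _ => fL t) sv) _.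
  by apply: ler_wpM2l; [exact: ltW|lra].
rewrite le_max => /orP[//|H]; exfalso.
have h1 : L * (v - u) <= L * (2 * r).
  apply: ler_wpM2l; first exact: ltW.
  move: ur vr; rewrite !ltr_norml => /andP[? ?] /andP[? ?]; lra.
have := KP t v; rewrite ler_norml => /andP[h2 _].
have h3 : K * `|v - t| <= K * r by apply: ler_wpM2l; apply: ltW.
lra.
Qed.

(** While the queue is positive, [queue_busy] gives the derivative. At a zero [t] of
    the queue, being Lipschitz, a value [y] at [v] forces the queue to be positive
    over a length of order [y] near [v], between [t] and [v]; so [y] is at most a
    constant times the measure of the busy set between [t] and [v], which is
    [o(v - t)] for almost every such [t]. Finally the queue minus the integral of
    [f] never decreases, so [f <= 0] where the derivative of the queue is zero. *)
Lemma queue_derive : {ae mu, forall t, 0 <= t ->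
  is_derive t 1 (queue f) (if 0 < queue f t then f t else 0) /\
  (queue f t = 0 -> f t <= 0)}.
Proof.
pose A := [set t | 0 < queue f t]; pose g : R -> R := \1_A.
have mA : measurable A by apply: open_measurable; exact: open_queue_gt0.
have bg : bmeas g.
  split; first exact: measurable_indic.
  by exists 1 => t; rewrite /g indicE; case: (_ \in _); rewrite ?normr1 ?normr0.
have [K K0 KP] := queue_lipschitz.
apply: filterS2 (itv_integral_ae_derive (-1) bf) (itv_integral_ae_derive (-1) bg).
  exact: (ae_filter_ringOfSetsType mu).
move=> t Hf Hg t0; have {Hf Hg} [Hf Hg] : is_derive t 1 (fun u => itv_integral f (-1) u) (f t) /\
    is_derive t 1 (fun u => itv_integral g (-1) u) (g t) by split; [apply: Hf|apply: Hg]; lra.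
have [xt|] := ltP 0 (queue f t).
  split; last by move=> x0; rewrite x0 ltxx in xt.
  apply/is_deriveP => e e0; have [r r0 rP] := (is_deriveP _ _ _).1 Hf e e0.
  have [r1 r10 r1P] := queue_busy xt.
  exists (Num.min 1 (Num.min r r1)); first by rewrite !lt_min ltr01 r0.
  move=> v; rewrite !lt_min => /and3P[v1 vr vr1].
  have -> : queue f v - queue f t = itv_integral f (-1) v - itv_integral f (-1) t; last exact: rP.
  move: v1; rewrite ltr_norml => /andP[v1 _].
  have [tv|/ltW vt] := leP t v.
    rewrite (r1P t v)//; last by rewrite subrr normr0.
    by rewrite (@itv_integral_chain _ f (-1) t v)//; [ring|lra].
  rewrite (r1P v t)//; last by rewrite subrr normr0.
  by rewrite (@itv_integral_chain _ f (-1) v t)//; [ring|lra].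
rewrite le_eqVlt ltNge queue_ge0 orbF => /eqP xt.
have gt0 : g t = 0 by rewrite /g indicE memNset//= /A/= xt ltxx.
have dx : is_derive t 1 (queue f) 0.
  apply/is_deriveP => e e0; have e1 : 0 < e / (2 * K) by rewrite divr_gt0// mulr_gt0.
  have [r r0 rP] := (is_deriveP _ _ _).1 Hg _ e1.
  exists (Num.min 1 r); first by rewrite !lt_min ltr01 r0.
  move=> v; rewrite !lt_min => /andP[v1 vr].
  rewrite xt mul0r !subr0 (ger0_norm (queue_ge0 v)).
  have [->|xv] := eqVneq (queue f v) 0; first by apply: mulr_ge0; [exact: ltW|exact: normr_ge0].
  have {}xv : 0 < queue f v by rewrite lt_def xv queue_ge0.
  have := rP v vr; rewrite gt0 mul0r subr0 => H.
  have vK : queue f v <= K * `|v - t| by have := KP t v; rewrite xt subr0 ger0_norm// queue_ge0.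
  (* half the distance from [v] over which the Lipschitz bound keeps the queue
     positive *)
  pose d := queue f v / (2 * K).
  have d0 : 0 < d by rewrite divr_gt0// mulr_gt0.
  have dE : K * d = queue f v / 2 by rewrite /d; field; rewrite gt_eqF.
  clearbody d.
  have dv : d <= `|v - t|.
    by rewrite -(@ler_pM2l _ K)//; lra.
  have pos w : `|w - v| <= d -> g w = 1.
    move=> wd; rewrite /g indicE mem_set//= /A/=.
    have := KP v w; have : K * `|w - v| <= K * d by apply: ler_wpM2l => //; exact: ltW.
    by move=> h1; rewrite ler_norml => /andP[h2 _]; lra.
  have g0 w : 0 <= g w by rewrite /g indicE.
  move: v1; rewrite ltr_norml => /andP[v1 _].
  suff h : d <= `|itv_integral g (-1) v - itv_integral g (-1) t|.
    have K2 : 0 <= 2 * K by rewrite mulr_ge0// ltW.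
    have := ler_wpM2l K2 (le_trans h H).
    rewrite (_ : 2 * K * (e / (2 * K) * `|v - t|) = e * `|v - t|); first lra.
    by field; rewrite gt_eqF.
  have [tv|/ltW vt] := leP t v.
    rewrite (@itv_integral_chain _ g (-1) t v)//; last lra.
    have {}dv : d <= v - t by move: dv; rewrite ger0_norm// subr_ge0.
    rewrite (addrC (itv_integral g (-1) t)) addrK; apply: le_trans (ler_norm _).
    have -> : d = itv_integral (cst 1) (v - d) v by rewrite itv_integral_cst ?mul1r ?gerBl ?ltW//; ring.
    rewrite (@itv_integral_eq _ _ g (v - d) v); first by apply: itv_integral_subitv => //; lra.
    by move=> w /andP[w1 w2]; rewrite pos// distrC ger0_norm ?subr_ge0//; lra.
  rewrite (@itv_integral_chain _ g (-1) v t)//; last lra.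
  have {}dv : d <= t - v by move: dv; rewrite distrC ger0_norm// subr_ge0.
  rewrite distrC (addrC (itv_integral g (-1) v)) addrK; apply: le_trans (ler_norm _).
  have -> : d = itv_integral (cst 1) v (v + d) by rewrite itv_integral_cst ?mul1r ?lerDl ?ltW//; ring.
  rewrite (@itv_integral_eq _ _ g v (v + d)); first by apply: itv_integral_subitv => //; lra.
  by move=> w /andP[w1 w2]; rewrite pos// ger0_norm ?subr_ge0//; lra.
split=> // _; apply/ler_addgt0Pl => e e0; rewrite addr0.
have e2 : 0 < e / 2 by lra.
have [r r0 rP] := (is_deriveP _ _ _).1 Hf _ e2.
have [r1 r10 r1P] := (is_deriveP _ _ _).1 dx _ e2.
pose d := Num.min r r1 / 2.
have m0 : 0 < Num.min r r1 by rewrite lt_min r0.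
have mr : Num.min r r1 <= r by rewrite ge_min lexx.
have mr1 : Num.min r r1 <= r1 by rewrite ge_min lexx orbT.
have d0 : 0 < d by rewrite /d; lra.
have dr : `|t + d - t| < r by rewrite addrC addKr gtr0_norm// /d; lra.
have dr1 : `|t + d - t| < r1 by rewrite addrC addKr gtr0_norm// /d; lra.
have := rP _ dr; have := r1P _ dr1; clear dr dr1; clearbody d.
rewrite (_ : t + d - t = d); last by ring.
rewrite mul0r subr0 (gtr0_norm d0) !ler_norml => /andP[_ h1] /andP[h2 _].
have h3 : queue f t + itv_integral f t (t + d) <= queue f (t + d) by apply: queue_ge_add; lra.
have h4 : itv_integral f (-1) (t + d) = itv_integral f (-1) t + itv_integral f t (t + d) by apply: itv_integral_chain => //; lra.
rewrite -(@ler_pM2r _ d)//; lra.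
Qed.

End Queue.

(** * Routing as a contraction *)
Section Finite.
Context {R : realType} {I : finType}.
Implicit Types (g : I -> R).

Lemma finite_lower_bound (P : pred I) g : (forall i, P i -> 0 < g i) ->
  exists2 k, 0 < k & forall i, P i -> k <= g i.
Proof.
move=> g0; exists (\big[Num.min/1]_(i | P i) g i).
  exact: (lt_bigmin _ ltr01 g0).
by move=> i Pi; exact: bigmin_le_cond.
Qed.

Lemma ler_sum_one g i : (forall j, 0 <= g j) -> g i <= \sum_j g j.
Proof. by move=> g0; rewrite (bigD1 i)//= lerDl sumr_ge0. Qed.

End Finite.

Section Routing.
Context {R : realType} {G : roadNetwork R}.
Hypotheses (Rsub : substochastic G) (Gconn : connectivity G).
Implicit Types (i j : link G) (v : link G -> R).

Lemma routing_ge0 j i : 0 <= routing j i. Proof. by case: Rsub. Qed.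

(** [survival n j] is the row sum of [j] in the [n]-th power of the routing matrix:
    the fraction of the flow of [j] still in the network after [n] moves. *)
Definition survival n : link G -> R :=
  iter n (fun v j => \sum_i routing j i * v i) (fun=> 1).

Lemma survival_ge0 n j : 0 <= survival n j.
Proof.
elim: n j => [|n IH] j /=; first exact: ler01.
by apply: sumr_ge0 => i _; rewrite mulr_ge0 ?routing_ge0.
Qed.

Lemma survivalS_le n j : survival n.+1 j <= survival n j.
Proof.
elim: n j => [|n IH] j.
  rewrite /survival/=; under eq_bigr do rewrite mulr1.
  by case: Rsub => _ + _; exact.
by apply: ler_sum => i _; apply: ler_wpM2l; [exact: routing_ge0|exact: IH].
Qed.

Lemma survival_le m n j : (m <= n)%N -> survival n j <= survival m j.
Proof.
elim: n => [|n IH]; first by rewrite leqn0 => /eqP ->.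
rewrite leq_eqVlt => /predU1P[->//|]; rewrite ltnS => /IH.
exact: le_trans (survivalS_le _ _).
Qed.

Lemma survival_routed i j n : routed i j -> survival n j < 1 -> survival n.+1 i < 1.
Proof.
move=> /= rij nj; apply: (@lt_le_trans _ _ (row_sum i)); last by case: Rsub.
rewrite /row_sum /survival/= -/(survival n) (bigD1 j)//= [ltRHS](bigD1 j)//=.
apply: ltr_leD; first by rewrite -[ltRHS]mulr1 ltr_pM2l.
apply: ler_sum => k _; rewrite -[leRHS]mulr1; apply: ler_wpM2l; first exact: routing_ge0.
exact: (@survival_le 0).
Qed.

(** Following a routed path from [i] to a leaky link, some flow is lost after as many
    moves as the path has links; finiteness makes the number of moves uniform. *)
Lemma survival_lt1 : exists N, forall i, survival N i < 1.
Proof.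
have ex1 i : exists n, survival n i < 1.
  have leaky j : row_sum j < 1 -> survival 1 j < 1.
    by rewrite /survival/=; under eq_bigr do rewrite mulr1.
  case: Gconn => _ /(_ i)[ri|[j [/connectP[p ip ->]]]]; first by exists 1%N; exact: leaky.
  elim: p i ip => [|k p IH] i /=; first by exists 1%N; exact: leaky.
  by move=> /andP[ik /IH] /[apply] -[n nk]; exists n.+1; exact: survival_routed nk.
have [N NP] := choice ex1; exists (\max_i N i)%N => i.
by apply: le_lt_trans (NP i); apply: survival_le; exact: leq_bigmax.
Qed.

(** The expected number of links still to be visited, truncated after [N] moves, is a
    strictly superharmonic weight: one move decreases it by [1 - survival N]. The
    weights are scaled to stay below 1. *)
Lemma routing_weights : exists w k, [/\ 0 < k, k <= 1, forall i : link G, 0 < w i <= 1 &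
  forall j : link G, \sum_i routing j i * w i + k <= w j].
Proof.
have [N NP] := survival_lt1.
pose w0 i := \sum_(n < N) survival n i.
have w01 i : 1 <= w0 i.
  have : (0 < N)%N by case: N NP {w0} => // /(_ i); rewrite /survival/= ltxx.
  rewrite /w0; case: N {NP w0} => // N _.
  rewrite -[leLHS]/(survival 0 i) big_ord_recl lerDl.
  by apply: sumr_ge0 => n _; exact: survival_ge0.
have [k k0 kP] := @finite_lower_bound R _ xpredT (fun i => 1 - survival N i)
  (fun i _ => ltac:(by rewrite subr_gt0)).
have Rw j : \sum_i routing j i * w0 i + k <= w0 j.
  have -> : \sum_i routing j i * w0 i = w0 j + survival N j - 1.
    rewrite /w0; under eq_bigr do rewrite mulr_sumr.
    rewrite exchange_big/= -(big_mkord xpredT (fun n => \sum_i routing j i * survival n i)).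
    rewrite -(big_mkord xpredT (survival^~ j)).
    have -> : \sum_(0 <= n < N) survival n j + survival N j = 1 + \sum_(0 <= n < N) survival n.+1 j.
      by rewrite -big_nat_recr//= big_nat_recl.
    by rewrite addrAC subrr add0r.
  have := kP j isT; lra.
pose W := 1 + k + \sum_i w0 i.
have S0 : 0 <= \sum_i w0 i by apply: sumr_ge0 => i _; rewrite (le_trans ler01).
have W0 : 0 < W by rewrite /W; lra.
exists (fun i => w0 i / W), (k / W); split.
- by rewrite divr_gt0.
- by rewrite ler_pdivrMr// mul1r /W; lra.
- move=> i; apply/andP; split; first by apply: divr_gt0 => //; exact: lt_le_trans (w01 i).
  rewrite ler_pdivrMr// mul1r.
  have := @ler_sum_one _ _ w0 i (fun j => le_trans ler01 (w01 j)); rewrite /W; lra.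
- move=> j; under eq_bigr do rewrite mulrA.
  by rewrite -mulr_suml -mulrDl ler_pM2r ?invr_gt0.
Qed.

(** Weighted by [w], routing loses at least [k] per unit of flow. *)
Lemma sum_routed_weights (w v : link G -> R) k : (forall i, 0 <= v i) ->
  (forall j, \sum_i routing j i * w i + k <= w j) ->
  \sum_i w i * (\sum_j routing j i * v j) <= \sum_j (w j - k) * v j.
Proof.
move=> v0 Rw; under eq_bigr do rewrite mulr_sumr.
rewrite exchange_big/=; apply: ler_sum => j _.
under eq_bigr do rewrite mulrA (mulrC (w _)).
by rewrite -mulr_suml; apply: ler_wpM2r => //; rewrite lerBrDr.
Qed.

Lemma subsolution0 v : (forall i, 0 <= v i) ->
  (forall i, v i <= \sum_j routing j i * v j) -> forall i, v i = 0.
Proof.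
move=> v0 vR; have [w [k [k0 _ w1 Rw]]] := routing_weights.
have h : \sum_i w i * v i <= \sum_j (w j - k) * v j.
  apply: le_trans (sum_routed_weights v0 Rw); apply: ler_sum => i _.
  by apply: ler_wpM2l => //; case/andP: (w1 i) => /ltW.
have : \sum_i k * v i <= 0.
  by rewrite -(lerD2l (\sum_j (w j - k) * v j)) addr0 -big_split/=;
    apply: le_trans h; apply: ler_sum => i _; lra.
rewrite -mulr_sumr pmulr_rle0// => s0 i.
by apply/eqP; rewrite eq_le v0 andbT (le_trans _ s0)//; exact: ler_sum_one.
Qed.

(** [inherited n i] is the column sum of [i] in the [n]-th power of the routing
    matrix. It bounds an error at [i] that has been passed along [n] moves. *)
Definition inherited n : link G -> R :=
  iter n (fun v i => \sum_j routing j i * v j) (fun=> 1).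

Lemma inherited_ge0 n j : 0 <= inherited n j.
Proof.
elim: n j => [|n IH] j /=; first exact: ler01.
by apply: sumr_ge0 => i _; rewrite mulr_ge0 ?routing_ge0.
Qed.

Lemma inherited_cvg0 i : inherited n i @[n --> \oo] --> (0 : R).
Proof.
have [w [k [k0 k1 w1 Rw]]] := routing_weights.
pose C := \sum_(i : link G) w i.
have B n : \sum_i w i * inherited n i <= (1 - k) ^+ n * C.
  elim: n => [|n IH]; first by rewrite expr0 mul1r; apply: ler_sum => j _; rewrite mulr1.
  apply: le_trans (sum_routed_weights (inherited_ge0 n) Rw) _.
  rewrite exprS -mulrA; apply: (@le_trans _ _ ((1 - k) * \sum_i w i * inherited n i)).
    rewrite mulr_sumr; apply: ler_sum => j _; rewrite mulrA; apply: ler_wpM2r.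
      exact: inherited_ge0.
    have /andP[wj0 wj1] := w1 j; nra.
  by apply: ler_wpM2l => //; lra.
have /andP[wi0 _] := w1 i.
apply: (@squeeze_cvgr _ _ _ _ (cst 0) (fun n => (1 - k) ^+ n * (C / w i))).
- near=> n; rewrite inherited_ge0/= mulrA ler_pdivlMr// mulrC (le_trans _ (B n))//.
  apply: (@ler_sum_one _ _ (fun j => w j * inherited n j)) => j.
  by rewrite mulr_ge0 ?inherited_ge0//; case/andP: (w1 j) => /ltW.
- exact: cvg_cst.
- rewrite -(mul0r (C / w i)); apply: cvgM; last exact: cvg_cst.
  by apply: cvg_expr; rewrite ger0_norm; lra.
Unshelve. all: by end_near. Qed.

(** A maximum principle in which the predecessors of [x] may be looked up at other
    points [y j], typically delayed times: iterating the inequality [n] times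
    bounds [e i x] by [K * inherited n i]. *)
Lemma bounded_subsolution0 (X : Type) (P : set X) (e : link G -> X -> R) K :
  (forall i x, P x -> 0 <= e i x <= K) ->
  (forall i x, P x -> exists2 y : link G -> X, forall j, P (y j) &
     e i x <= \sum_j routing j i * e j (y j)) ->
  forall i x, P x -> e i x = 0.
Proof.
move=> eK eR.
have bnd n i x : P x -> e i x <= K * inherited n i.
  elim: n i x => [|n IH] i x Px; first by rewrite mulr1; case/andP: (eK i x Px).
  have [y Py ey] := eR i x Px.
  apply: le_trans ey _; rewrite /= mulr_sumr; apply: ler_sum => j _.
  by rewrite mulrCA; apply: ler_wpM2l; [exact: routing_ge0|exact: IH].
move=> i x Px; apply/eqP; rewrite eq_le; have /andP[-> _] := eK i x Px; rewrite andbT.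
have H : K * inherited n i @[n --> \oo] --> (0 : R).
  by rewrite -(mulr0 K); apply: cvgM; [exact: cvg_cst|exact: inherited_cvg0].
rewrite -(cvg_lim _ H)//; apply: limr_ge; first by apply/cvg_ex; exists 0.
by near=> n; exact: bnd.
Unshelve. all: by end_near. Qed.

(** Without an a priori bound, vanishing before time 0 suffices. One advances by
    steps no longer than any positive delay: delayed terms vanish already, and the
    undelayed ones are settled by [subsolution0] at each instant. *)
Lemma causal_delayed_subsolution0 (e : link G -> R -> R) :
  (forall i t, 0 <= e i t) -> (forall i t, t < 0 -> e i t = 0) ->
  (forall i t, 0 <= t -> e i t <= \sum_j routing j i * e j (t - delay j i)) ->
  forall i t, e i t = 0.
Proof.
move=> e0 eneg eR.
have [d d0 dP] := @finite_lower_bound R (link G * link G)%type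
  (fun p => 0 < delay p.1 p.2) (fun p => delay p.1 p.2) (fun _ => id).
have step n : forall i t, t < n%:R * d -> e i t = 0.
  elim: n => [|n IH] i t tn; first by apply: eneg; rewrite mul0r in tn.
  have [t0|/eneg//] := leP 0 t.
  apply: (@subsolution0 (e^~ t)) => [j|{}i]; first exact: e0.
  apply: le_trans (eR i t t0) _; apply: ler_sum => j _; apply: ler_wpM2l; first exact: routing_ge0.
  have := @delay_ge0 _ G j i; rewrite le_eqVlt => /predU1P[<-|dji]; first by rewrite subr0.
  rewrite IH//; have := dP (j, i) dji => /= h.
  by move: tn; rewrite -natr1 mulrDl mul1r; lra.
move=> i t; apply: (step (Num.truncn (`|t| / d)).+1).
rewrite (le_lt_trans (ler_norm t))// -ltr_pdivrMr//.
by case/andP: (truncn_itv (divr_ge0 (normr_ge0 t) (ltW d0))).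
Qed.

End Routing.

(** * The linear program *)
Section LinearProgram.
Context {R : realType} {G : roadNetwork R}.
Hypotheses (Rsub : substochastic G) (Gconn : connectivity G).
Variables lambda c : link G -> R -> R.
Implicit Types (i j : link G) (x z : link G -> R -> R).

(** Delayed and undelayed arrivals together, a zero delay being no exception. *)
Definition inflow z i t := lambda i t + \sum_j routing j i * z j (t - delay j i).

Definition outflow x z i t :=
  if x i t == 0 then Num.min (c i t) (inflow z i t) else c i t.

Lemma inflowE z i t :
  exo_inflow lambda z i t + \sum_(j | undelayed j i) routing j i * z j t = inflow z i t.
Proof.
rewrite /exo_inflow /inflow -addrA; congr (_ + _).
rewrite addrC [RHS](bigID (fun j => undelayed j i))/=; congr (_ + _).
by apply: eq_bigr => j /andP[_ /eqP ->]; rewrite subr0.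
Qed.

(** At an optimum each coordinate reaches its bound: raising one coordinate relaxes
    the constraints of the others because routing is nonnegative. *)
Lemma lp_optimal_outflow x z t : lp_optimal lambda c x z t (fun=> 1) (z^~ t) ->
  forall i, z i t = outflow x z i t.
Proof.
move=> [[zc zx] opt] i; apply/eqP; rewrite eq_le; apply/andP; split.
  rewrite /outflow; case: eqVneq => [x0|_]; last exact: zc.
  by rewrite le_min zc -inflowE zx.
rewrite leNgt; apply/negP => lt; set b := outflow x z i t in lt.
pose w j := if j == i then b else z j t.
have zw j : z j t <= w j by rewrite /w; case: eqVneq => // ->; exact: ltW.
suff /opt : lp_feasible lambda c x z t w.
  apply/negP; rewrite -ltNge (bigD1 i)//= [ltRHS](bigD1 i)//= !mul1r.
  by apply: ltr_leD; [rewrite /w eqxx|apply: ler_sum => j _; rewrite !mul1r].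
have sumw j : \sum_(k | undelayed k j) routing k j * z k t <=
    \sum_(k | undelayed k j) routing k j * w k.
  by apply: ler_sum => k _; apply: ler_wpM2l => //; exact: routing_ge0.
split=> j.
  rewrite /w; case: eqVneq => [->|_]; last exact: zc.
  by rewrite /b /outflow; case: ifP => // _; rewrite ge_min lexx.
move=> xj; apply: (@le_trans _ _ (inflow z j t)); last by rewrite -inflowE lerD2l.
rewrite /w; case: (eqVneq j i) => [ji|_]; last by rewrite -inflowE zx.
by rewrite /b /outflow -ji xj eqxx ge_min lexx orbT.
Qed.

(** Conversely the solution of the equations dominates every feasible point, by the
    maximum principle for the positive part of the difference; hence it is optimal
    for all positive objectives at once. *)
Lemma outflow_lp_optimal x z t eta : (forall i, 0 < eta i) ->
  (forall i, z i t = outflow x z i t) -> lp_optimal lambda c x z t eta (z^~ t).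
Proof.
move=> eta0 zE; split.
  split=> i; first by rewrite zE /outflow; case: ifP => // _; rewrite ge_min lexx.
  by move=> xi; rewrite inflowE [leLHS]zE /outflow xi eqxx ge_min lexx orbT.
move=> v [vc vx]; apply: ler_sum => i _; apply: ler_wpM2l; first exact: ltW.
pose e j := Num.max 0 (v j - z j t).
have e0 j : 0 <= e j by rewrite le_max lexx.
suff : e i = 0 by move=> h; rewrite -subr_le0 -h le_max lexx orbT.
apply: (subsolution0 Rsub Gconn) => // {}i.
have s0 : 0 <= \sum_j routing j i * e j.
  by apply: sumr_ge0 => j _; rewrite mulr_ge0 ?routing_ge0.
rewrite ge_max s0 /=.
have vi := vc i; have [xi|xi] := eqVneq (x i t) 0; last first.
  by apply: le_trans s0; rewrite subr_le0 zE /outflow (negbTE xi).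
have [ci|ic] := leP (c i t) (inflow z i t).
  by apply: le_trans s0; rewrite subr_le0 zE /outflow xi eqxx min_l.
have -> : z i t = inflow z i t by rewrite zE /outflow xi eqxx min_r// ltW.
rewrite lerBlDr (le_trans (vx i xi))// -inflowE addrCA lerD2l.
apply: (@le_trans _ _ (\sum_(j | undelayed j i) (routing j i * e j + routing j i * z j t))).
  apply: ler_sum => j _; rewrite -mulrDr; apply: ler_wpM2l; first exact: routing_ge0.
  by rewrite -lerBlDr le_max lexx orbT.
rewrite big_split/= lerD2r [leRHS](bigID (fun j => undelayed j i))/= lerDl.
by apply: sumr_ge0 => j _; rewrite mulr_ge0 ?routing_ge0.
Qed.

End LinearProgram.

(** * Periodic functions *)
Lemma dist_min_cst (R : realType) (a x y : R) :
  `|Num.min a x - Num.min a y| <= `|x - y|.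
Proof.
by rewrite ler_norml; have := ler_norm (x - y); have := ler_norm (- (x - y)); rewrite normrN;
  have := normr_ge0 (x - y);
  case: (leP a x) => ax; case: (leP a y) => ay h0 h1 h2; apply/andP; split; lra.
Qed.

Lemma cvg_min_cst (R : realType) (a l : R) (u : nat -> R) :
  u n @[n --> \oo] --> l -> Num.min a (u n) @[n --> \oo] --> Num.min a l.
Proof.
move=> /cvgrPdist_lt ul; apply/cvgrPdist_lt => e e0; near=> n.
by apply: le_lt_trans (dist_min_cst _ _ _) _; near: n; exact: ul.
Unshelve. all: by end_near. Qed.

Section Periodic.
Context {R : realType}.
Implicit Types (f g F : R -> R) (a b t T : R).

Lemma bmeas_itv_if a b f g : bmeas f -> bmeas g ->
  bmeas (fun t => if a <= t < b then f t else g t).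
Proof.
move=> bf bg; have mI : measurable (`[a, b[%classic : set R) by [].
have := bmeas_if mI bf bg; congr bmeas; apply/funext => t.
suff -> : (t \in `[a, b[%classic) = (a <= t < b) by [].
by apply/idP/idP => [/set_mem|h]; [|apply/mem_set]; rewrite /= in_itv.
Qed.

Lemma piecewise_constant_bmeas a b f : piecewise_constant a b f ->
  bmeas (fun t => if a <= t < b then f t else 0).
Proof.
move=> [s]; elim: s a => [|c s IH] a /=.
  move=> /itv_partition_nil -> _.
  rewrite (_ : (fun _ => _) = cst 0); first exact: bmeas_cst.
  by apply/funext => t; case: ifP => // /andP[h1 h2]; have := le_lt_trans h1 h2; rewrite ltxx.
move=> Ps fP; have [ac Ps'] : a < c /\ itv_partition c b s.
  by split; [case: Ps => /andP[]|exact: itv_partition_cons Ps].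
have cb := itv_partition_le Ps'.
have bg : bmeas (fun t => if c <= t < b then f t else 0).
  by apply: (IH c Ps') => k ks; apply: (fP k.+1).
have := bmeas_itv_if a c (bmeas_cst (f a)) bg; congr bmeas; apply/funext => t /=.
case: ifPn => [/andP[at_ tc]|].
  rewrite at_ (lt_le_trans tc cb)/=; apply: (fP 0%N) => //=; rewrite in_itv/=.
    by rewrite lexx.
  by rewrite at_.
rewrite negb_and -leNgt -ltNge => /orP[ta|ct].
  by rewrite !leNgt ta (lt_trans ta ac).
by rewrite ct (le_trans (ltW ac) ct).
Qed.

Definition has_period T F := forall t, F (t + T) = F t.

Lemma periodic_nat T F n t : has_period T F -> F (t + n%:R * T) = F t.
Proof.
move=> FT; elim: n t => [|n IH] t; first by rewrite mul0r addr0.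
by rewrite -natr1 mulrDl mul1r addrA FT IH.
Qed.

Lemma periodic_int T F (m : int) t : has_period T F -> F (t + m%:~R * T) = F t.
Proof.
move=> FT; case: m => n; first exact: periodic_nat.
by rewrite NegzE -(periodic_nat n.+1 _ FT) rmorphN/= mulNr addrNK.
Qed.

Lemma floor_period T t : 0 < T -> 0 <= t - (Num.floor (t / T))%:~R * T < T.
Proof.
move=> T0; have /andP[] := floor_itv (t / T).
rewrite ler_pdivlMr// ltr_pdivrMr// => h1; rewrite rmorphD/= mulrDl mul1r => h2.
by apply/andP; split; lra.
Qed.

(** The inputs are meaningful for nonnegative times only. Extending them to the whole
    line gives the stationary regime an infinite past. *)
Lemma periodic_extension T f : 0 < T -> piecewise_constant 0 T f ->
  (forall t, 0 <= t -> f (t + T) = f t) -> (forall t, 0 <= t -> 0 <= f t) ->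
  exists F, [/\ bmeas F, has_period T F, forall t, 0 <= t -> f t = F t & forall t, 0 <= F t].
Proof.
move=> T0 pcf fT f0; pose fr (t : R) : R := t - (Num.floor (t / T))%:~R * T.
have frP t : 0 <= fr t < T by exact: floor_period.
have frT t : fr (t + T) = fr t.
  rewrite /fr mulrDl divff ?gt_eqF// floorDrz// floor1 rmorphD/= mulrDl mul1r; ring.
exists (f \o fr); split=> [||t t0|t]; last 3 first.
- by move=> t /=; rewrite frT.
- rewrite /= /fr; have : 0 <= Num.floor (t / T) by rewrite floor_ge0 divr_ge0// ltW.
  have := frP t; rewrite /fr; case: (Num.floor (t / T)) => // n /andP[h0 _] _.
  have fn k u : 0 <= u -> f (u + k%:R * T) = f u.
    elim: k u => [|k IH] u u0; first by rewrite mul0r addr0.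
    rewrite -natr1 mulrDl mul1r addrA fT ?IH//.
    by rewrite addr_ge0// mulr_ge0// ltW.
  by rewrite -[in LHS](subrK (n%:R * T) t) fn.
- by apply: f0; case/andP: (frP t).
have [mf [K fK]] := piecewise_constant_bmeas pcf.
rewrite (_ : f \o fr = (fun t => if 0 <= t < T then f t else 0) \o fr); last first.
  by apply/funext => t /=; rewrite frP.
split; last by exists K => t; exact: fK.
apply: measurableT_comp mf _; apply: measurable_funB => //.
apply: measurable_funM => //; apply: nondecreasing_measurable => // u v uv.
by rewrite ler_int le_floor// ler_pM2r// invr_gt0.
Qed.

Lemma itv_integral_periodic_shift T F (m : int) a b : bmeas F -> has_period T F ->
  itv_integral F (a + m%:~R * T) (b + m%:~R * T) = itv_integral F a b.
Proof.
move=> bF FT; rewrite -[m%:~R * T]opprK -itv_integral_shift//.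
by apply: itv_integral_eq => t _; rewrite opprK periodic_int.
Qed.

Lemma itv_integral_period T F t : 0 < T -> bmeas F -> has_period T F ->
  itv_integral F t (t + T) = itv_integral F 0 T.
Proof.
move=> T0 bF FT; have /andP[m0 mT] := floor_period t T0; set m := Num.floor _ in m0 mT.
set u := t - m%:~R * T in m0 mT.
have tE : t = u + m%:~R * T by rewrite /u subrK.
clearbody u; rewrite tE addrAC itv_integral_periodic_shift// (@itv_integral_chain _ F u T)//; last 2 first.
- exact: ltW.
- by rewrite lerDr.
have -> : itv_integral F T (u + T) = itv_integral F 0 u.
  by have := itv_integral_periodic_shift 1 0 u bF FT; rewrite add0r mul1r.
by rewrite addrC -itv_integral_chain// ltW.
Qed.

End Periodic.

(** * The periodic regime *)
Section Regime.
Context {R : realType} {G : roadNetwork R}.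
Hypotheses (Rsub : substochastic G).
Variables (lambda c : link G -> R -> R) (T : R).
Hypotheses (T0 : 0 < T)
  (bl : forall i, bmeas (lambda i)) (bc : forall i, bmeas (c i))
  (lT : forall i, has_period T (lambda i)) (cT : forall i, has_period T (c i))
  (l0 : forall i t, 0 <= lambda i t) (c0 : forall i t, 0 <= c i t)
  (stable : forall i, itv_integral (lambda i) 0 T + \sum_j routing j i * itv_integral (c j) 0 T < itv_integral (c i) 0 T).
Implicit Types (i j : link G) (z : link G -> R -> R) (t s : R).

Definition net_inflow z i t := inflow lambda z i t - c i t.

(** The departures produced by the stationary queues when arrivals are computed from
    the departures [z]; the periodic regime is a fixed point of this operator. *)
Definition served z i := outflow lambda c (fun i => queue (net_inflow z i)) z i.

Definition admissible z := forall i,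
  [/\ bmeas (z i), has_period T (z i) & forall t, 0 <= z i t <= c i t].

Lemma bmeas_inflow z i : (forall j, bmeas (z j)) -> bmeas (inflow lambda z i).
Proof.
move=> bz; apply: bmeasD => //; apply: bmeas_sum => j.
by apply: bmeasZ; apply: bmeas_shift.
Qed.

Lemma le_inflow z z' i : (forall j t, z j t <= z' j t) ->
  forall t, inflow lambda z i t <= inflow lambda z' i t.
Proof.
move=> zz' t; rewrite lerD2l; apply: ler_sum => j _.
by apply: ler_wpM2l; [exact: routing_ge0|exact: zz'].
Qed.

Lemma inflow_ge0 z i t : (forall j t, 0 <= z j t) -> 0 <= inflow lambda z i t.
Proof.
move=> z0; rewrite addr_ge0// sumr_ge0// => j _.
by rewrite mulr_ge0//; exact: routing_ge0.
Qed.

Section Admissible.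
Variable z : link G -> R -> R.
Hypothesis az : admissible z.

Let bz j : bmeas (z j). Proof. by case: (az j). Qed.
Let zT j : has_period T (z j). Proof. by case: (az j). Qed.

Lemma bmeas_net i : bmeas (net_inflow z i).
Proof. by apply: bmeasB => //; exact: bmeas_inflow. Qed.

Lemma periodic_inflow i : has_period T (inflow lambda z i).
Proof.
move=> t; rewrite /inflow lT; congr (_ + _); apply: eq_bigr => j _.
by rewrite addrAC zT.
Qed.

Lemma periodic_net i : has_period T (net_inflow z i).
Proof. by move=> t; rewrite /net_inflow periodic_inflow cT. Qed.

(** If departures stay below capacity, the mean of the routed flow is at most that of
    [R^T c], to which the stability condition applies. *)
Lemma itv_integral_inflow_lt i : itv_integral (inflow lambda z i) 0 T < itv_integral (c i) 0 T.
Proof.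
apply: le_lt_trans (stable i).
rewrite /inflow itv_integralD//; last first.
  by apply: bmeas_sum => j; apply: bmeasZ; apply: bmeas_shift.
rewrite itv_integral_sum; last by move=> j; apply: bmeasZ; apply: bmeas_shift.
rewrite lerD2l; apply: ler_sum => j _; rewrite itv_integralZ; last exact: bmeas_shift.
apply: ler_wpM2l; first exact: routing_ge0.
rewrite itv_integral_shift// (_ : T - delay j i = - delay j i + T); last by rewrite addrC.
rewrite sub0r itv_integral_period//; apply: itv_integral_le => // t _.
by have [_ _ /(_ t)/andP[]] := az j.
Qed.

Lemma itv_integral_net_le0 i t : itv_integral (net_inflow z i) t (t + T) <= 0.
Proof.
rewrite itv_integral_period//; [|exact: bmeas_net|exact: periodic_net].
rewrite /net_inflow itv_integralB//; last exact: bmeas_inflow.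
by rewrite subr_le0 ltW// itv_integral_inflow_lt.
Qed.

Lemma admissible_served : admissible (served z).
Proof.
move=> i; have bn := bmeas_net i; have nT := itv_integral_net_le0 i.
have z0 j t : 0 <= z j t by have [_ _ /(_ t)/andP[]] := az j.
split.
- have mA : measurable [set t | 0 < queue (net_inflow z i) t].
    by apply: open_measurable; exact: (open_queue_gt0 bn T0 nT).
  have := bmeas_if mA (bc i) (bmeas_min (bc i) (bmeas_inflow i bz)).
  congr bmeas; apply/funext => t; rewrite /served /outflow.
  have q0 := queue_ge0 bn T0 nT t.
  case: eqVneq => [qt|qt].
    by rewrite memNset//= qt ltxx.
  by rewrite mem_set//= lt_def qt.
- move=> t; rewrite /served /outflow periodic_inflow cT queue_periodic//.
  exact: periodic_net.
- move=> t; rewrite /served /outflow; case: ifP => _; last by rewrite c0 lexx.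
  by rewrite le_min c0 inflow_ge0//= ge_min lexx.
Qed.

End Admissible.

(** A larger inflow gives a larger queue; a link with a positive queue departs at
    capacity, and a link with an empty queue departs at [min c a]. *)
Lemma le_served z z' : admissible z -> admissible z' -> (forall j t, z j t <= z' j t) ->
  forall i t, served z i t <= served z' i t.
Proof.
move=> az az' zz' i t; rewrite /served /outflow.
have qq : queue (net_inflow z i) t <= queue (net_inflow z' i) t.
  apply: (queue_le (bmeas_net az i) T0 (itv_integral_net_le0 az i)) => s st.
  apply: le_trans (queue_ge_integral (bmeas_net az' i) T0 (itv_integral_net_le0 az' i) st).
  apply: itv_integral_le; [exact: bmeas_net..|] => u _; rewrite lerD2r; exact: le_inflow.
have q0 := queue_ge0 (bmeas_net az i) T0 (itv_integral_net_le0 az i) t.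
case: eqVneq => [qz|qz]; case: eqVneq => [qz'|qz'] //.
- by rewrite le_min ge_min lexx/= ge_min le_inflow ?orbT.
- by rewrite ge_min lexx.
- by exfalso; move: qq; rewrite qz' => qq; move/eqP: qz; apply; apply/eqP; rewrite eq_le qq.
Qed.

Definition filling n := iter n served (fun _ _ => 0).

Lemma admissible_filling n : admissible (filling n).
Proof.
elim: n => [|n IH]; last exact: admissible_served.
by move=> i; split=> //; [exact: (bmeas_cst 0)|move=> t; rewrite lexx c0].
Qed.

Lemma filling_nondecreasing i t : nondecreasing_seq (fun n => filling n i t).
Proof.
apply/nondecreasing_seqP => n; elim: n i t => [|n IH] i t.
  by have [_ _ /(_ t)/andP[]] := admissible_filling 1 i.
by apply: le_served => //; [exact: admissible_filling|exact: (admissible_filling n.+1)].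
Qed.

Definition regime i t := limn (fun n => filling n i t).

Lemma filling_is_cvg i t : cvgn (fun n => filling n i t).
Proof.
apply: nondecreasing_is_cvgn; first exact: filling_nondecreasing.
exists (c i t) => _ [n _ <-]; by have [_ _ /(_ t)/andP[]] := admissible_filling n i.
Qed.

Lemma filling_cvg i t : filling n i t @[n --> \oo] --> regime i t.
Proof. exact: filling_is_cvg. Qed.

Lemma admissible_regime : admissible regime.
Proof.
move=> i; have fc n t : 0 <= filling n i t <= c i t by have [_ _] := admissible_filling n i.
have zc t : 0 <= regime i t <= c i t.
  apply/andP; split.
    apply: limr_ge; first exact: filling_is_cvg.
    by apply: nearW => n; case/andP: (fc n t).
  apply: limr_le; first exact: filling_is_cvg.
  by apply: nearW => n; case/andP: (fc n t).
split=> //.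
  split.
    apply: (@measurable_fun_cvg _ _ _ _ (fun n => filling n i)) => [n|t _]; last exact: filling_cvg.
    by have [[]] := admissible_filling n i.
  have [_ [K cK]] := bc i; exists K => t; apply: le_trans (cK t).
  by have /andP[h1 h2] := zc t; rewrite !ger0_norm.
move=> t; rewrite /regime; congr (limn _); apply/funext => n.
by have [_ ->] := admissible_filling n i.
Qed.

Lemma inflow_filling_cvg i t :
  inflow lambda (filling n) i t @[n --> \oo] --> inflow lambda regime i t.
Proof.
apply: cvgD; first exact: cvg_cst.
apply: cvg_big => [|j _]; first exact: add_continuous.
by apply: cvgM; [exact: cvg_cst|exact: filling_cvg].
Qed.

Lemma le_filling_regime n i t : filling n i t <= regime i t.
Proof.
apply: nondecreasing_cvgn_le; first exact: filling_nondecreasing.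
exact: filling_is_cvg.
Qed.

(** If the limiting queue is empty at [t], so are all the earlier ones, and both sides
    are limits of [min c a]. If it is positive, some integral in its supremum is
    positive, hence also that of all late iterates, whose queues are then positive
    and whose departures equal the capacity. *)
Lemma regimeE i t : regime i t = served regime i t.
Proof.
have ar := admissible_regime; have af := admissible_filling.
have cvgS : filling n.+1 i t @[n --> \oo] --> regime i t.
  by rewrite (cvg_shiftS (fun n => filling n i t)); exact: filling_cvg.
have q0 := queue_ge0 (bmeas_net ar i) T0 (itv_integral_net_le0 ar i) t.
apply: (cvg_unique _ cvgS); first exact: norm_hausdorff.
rewrite /served /outflow; case: eqVneq => [qt|qt].
  rewrite (_ : (fun n => _) = (fun n => Num.min (c i t) (inflow lambda (filling n) i t))).
    by apply: cvg_min_cst; exact: inflow_filling_cvg.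
  apply/funext => n; rewrite /filling iterS -/(filling n) /served /outflow.
  suff -> : queue (net_inflow (filling n) i) t = 0 by rewrite eqxx.
  apply/eqP; rewrite eq_le (queue_ge0 (bmeas_net (af n) i) T0 (itv_integral_net_le0 (af n) i)) andbT.
  rewrite -qt; apply: (queue_le (bmeas_net (af n) i) T0 (itv_integral_net_le0 (af n) i)) => s st.
  apply: le_trans (queue_ge_integral (bmeas_net ar i) T0 (itv_integral_net_le0 ar i) st).
  apply: itv_integral_le; [exact: bmeas_net..|] => u _; rewrite lerD2r; apply: le_inflow => j w.
  exact: le_filling_regime.
have {q0 qt} qt : 0 < queue (net_inflow regime i) t by rewrite lt_def qt.
have [s st s0] : exists2 s, s <= t & 0 < itv_integral (net_inflow regime i) s t.
  apply: contrapT => H; suff : queue (net_inflow regime i) t <= 0 by rewrite leNgt qt.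
  apply: (queue_le (bmeas_net ar i) T0 (itv_integral_net_le0 ar i)) => s st; rewrite leNgt.
  by apply/negP => s0; apply: H; exists s.
have [K nK] : exists K, forall n u, `|net_inflow (filling n) i u| <= K.
  have [_ [K1 h1]] := bmeas_inflow i (fun j => bc j); have [_ [K2 h2]] := bc i.
  exists (K1 + K2) => n u; apply: le_trans (ler_normB _ _) _; apply: lerD => //.
  apply: le_trans (h1 u); rewrite !ger0_norm.
  - by apply: le_inflow => j w; have [_ _ /(_ w)/andP[]] := af n j.
  - exact: inflow_ge0.
  - by apply: inflow_ge0 => j w; have [_ _ /(_ w)/andP[]] := af n j.
have : itv_integral (net_inflow (filling n) i) s t @[n --> \oo] --> itv_integral (net_inflow regime i) s t.
  apply: (itv_integral_cvg (K := K)) => //; [by move=> n; exact: bmeas_net|exact: bmeas_net|].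
  by move=> u; apply: cvgB; [exact: inflow_filling_cvg|exact: cvg_cst].
move=> /cvgr_gt/(_ _ s0) H; apply: cvg_near_cst; near=> n.
rewrite /filling iterS -/(filling n) /served /outflow ifF//; apply/negbTE.
rewrite gt_eqF//; apply: lt_le_trans (queue_ge_integral (bmeas_net (af n) i) T0 (itv_integral_net_le0 (af n) i) st).
by near: n; exact: H.
Unshelve. all: by end_near. Qed.

End Regime.

(** * Trajectories *)
(** Departures [min c a] and spill [a - min c a] are both nondecreasing in [a], so
    their variations add up. *)
Lemma norm_min_split (R : realType) (c a b : R) :
  `|a - b - (Num.min c a - Num.min c b)| <= `|a - b| - `|Num.min c a - Num.min c b|.
Proof.
set p := Num.min c a; set q := Num.min c b.
have hp : (p = a /\ a <= c) \/ (p = c /\ c <= a).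
  by rewrite /p; case: (leP c a) => h; [right|left; split=> //; exact: ltW].
have hq : (q = b /\ b <= c) \/ (q = c /\ c <= b).
  by rewrite /q; case: (leP c b) => h; [right|left; split=> //; exact: ltW].
move: p q hp hq => p q [[-> h1]|[-> h1]] [[-> h2]|[-> h2]].
- by rewrite subrr normr0 subrr.
- rewrite (_ : a - b - (a - c) = c - b); last by ring.
  by rewrite !ler0_norm ?subr_le0 ?(le_trans h1)//; lra.
- rewrite (_ : a - b - (c - b) = a - c); last by ring.
  by rewrite !ger0_norm ?subr_ge0 ?(le_trans h2)//; lra.
- by rewrite subrr normr0 !subr0.
Qed.

Section Outflow.
Context {R : realType} {G : roadNetwork R}.
Hypotheses (Rsub : substochastic G) (Gconn : connectivity G).
Variables (lambda c : link G -> R -> R).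
Implicit Types (i j : link G) (x z : link G -> R -> R) (t : R).
Notation inflow := (inflow lambda).
Notation outflow := (outflow lambda c).

Lemma outflow_le x z i t : outflow x z i t <= c i t.
Proof. by rewrite /outflow; case: ifP => // _; rewrite ge_min lexx. Qed.

Lemma dist_inflow z z' i t : `|inflow z i t - inflow z' i t| <=
  \sum_j routing j i * `|z j (t - delay j i) - z' j (t - delay j i)|.
Proof.
rewrite /inflow opprD addrACA subrr add0r -sumrB.
apply: le_trans (ler_norm_sum _ _ _) _; apply: ler_sum => j _.
by rewrite -mulrBr normrM ger0_norm//; exact: routing_ge0.
Qed.

Lemma dist_outflow x z z' i t : `|outflow x z i t - outflow x z' i t| <=
  \sum_j routing j i * `|z j (t - delay j i) - z' j (t - delay j i)|.
Proof.
apply: le_trans (dist_inflow z z' i t); rewrite /outflow; case: ifP => _.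
  exact: dist_min_cst.
by rewrite subrr normr0.
Qed.

(** [k] is the derivative of [x i - x' i], and [m] bounds that of its absolute value:
    a discrepancy in departures always works towards closing the gap between the
    queues, since the link with the longer queue departs at capacity. When both
    queues are empty this is [norm_min_split]. *)
Lemma queue_discrepancy x x' z z' i t : 0 <= x i t -> 0 <= x' i t ->
  z i t = outflow x z i t -> z' i t = outflow x' z' i t ->
  let k := inflow z i t - inflow z' i t - (z i t - z' i t) in
  let m := \sum_j routing j i * `|z j (t - delay j i) - z' j (t - delay j i)|
           - `|z i t - z' i t| in
  [/\ x i t - x' i t = 0 -> `|k| <= m, 0 < x i t - x' i t -> k <= m &
      x i t - x' i t < 0 -> - k <= m].
Proof.
move=> x0 x'0 zE z'E; have := dist_inflow z z' i t.
have zc : z i t <= c i t by rewrite zE outflow_le.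
have z'c : z' i t <= c i t by rewrite z'E outflow_le.
rewrite /outflow in zE z'E.
move: zE z'E; move: (\sum_j _) (inflow z i t) (inflow z' i t).
move=> S a a' zE z'E aa' k m; rewrite {}/k {}/m.
have /ler_normlP[a1 a2] := aa'.
split.
- move=> /subr0_eq xx'.
  have {zE z'E} : (z i t = c i t /\ z' i t = c i t) \/
      (z i t = Num.min (c i t) a /\ z' i t = Num.min (c i t) a').
    by rewrite zE z'E xx'; case: ifP => _; [right|left].
  case=> -[-> ->]; first by rewrite subrr normr0 !subr0.
  apply: le_trans (_ : _ <= `|a - a'| - `|Num.min (c i t) a - Num.min (c i t) a'|) _; last first.
    by rewrite lerD2r.
  exact: norm_min_split.
- rewrite subr_gt0 => xx'.
  have -> : z i t = c i t by rewrite zE gt_eqF// (le_lt_trans x'0).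
  by rewrite ger0_norm ?subr_ge0//; lra.
- rewrite subr_lt0 => xx'.
  have -> : z' i t = c i t by rewrite z'E gt_eqF// (le_lt_trans x0).
  by rewrite ler0_norm ?subr_le0//; lra.
Qed.

End Outflow.

Section Trajectories.
Context {R : realType} {G : roadNetwork R}.
Notation mu := (@lebesgue_measure R).
Hypotheses (Rsub : substochastic G) (Gconn : connectivity G).
Variables (lambda c : link G -> R -> R).
Hypotheses
  (bl : forall i, bmeas (lambda i)) (bc : forall i, bmeas (c i))
  (l0 : forall i t, 0 <= lambda i t) (c0 : forall i t, 0 <= c i t).
Implicit Types (i j : link G) (t s : R).
Notation inflow := (inflow lambda).
Notation outflow := (outflow lambda c).

Lemma delay_le_max_from i j : 0 < routing j i -> delay j i <= max_delay_from j.
Proof. by move=> rji; exact: le_bigmax_cond. Qed.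

Lemma max_delay_from_ge0 j : 0 <= max_delay_from j.
Proof. exact: bigmax_ge_id. Qed.

Lemma max_delay_from_le j : max_delay_from j <= max_delay G.
Proof.
apply: bigmax_le; first exact: bigmax_ge_id.
by move=> i rji; exact: (le_bigmax_cond 0 (j := (j, i)) (P := fun p : link G * link G => 0 < routing p.1 p.2) (fun p => delay p.1 p.2)).
Qed.

(** Departures before the history are meaningless; they are set to zero so as to get
    bounded functions on the whole line. *)
Definition truncated z j t : R := if - max_delay_from j <= t then z j t else 0.

Lemma truncated_ge0E z j t : 0 <= t -> truncated z j t = z j t.
Proof.
by move=> t0; rewrite /truncated ifT// (le_trans _ t0)// oppr_le0 max_delay_from_ge0.
Qed.

Lemma inflow_truncated z i t : 0 <= t -> inflow (truncated z) i t = inflow z i t.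
Proof.
move=> t0; congr (_ + _); apply: eq_bigr => j _.
have := routing_ge0 Rsub j i; rewrite le_eqVlt => /predU1P[<-|rji]; first by rewrite !mul0r.
rewrite /truncated ifT//; have := delay_le_max_from rji; lra.
Qed.

Lemma bmeas_history f (a b K : R) : mu.-integrable `[a, b[ (EFin \o f) ->
  (forall t, a <= t < b -> `|f t| <= K) ->
  bmeas (fun t => if a <= t < b then f t else 0).
Proof.
move=> /integrableP[/measurable_EFinP mf _] fK; split; last first.
  by exists `|K| => t; case: ifP => [/fK h|_]; [exact: le_trans h (ler_norm K)|rewrite normr0].
move/(measurable_restrictT _ _).1 : mf => /(_ ltac:(by [])); congr (measurable_fun _ _).
apply/funext => t; rewrite /patch.
suff -> : (t \in `[a, b[%classic) = (a <= t < b) by [].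
by apply/idP/idP => [/set_mem|h]; [|apply/mem_set]; rewrite /= in_itv.
Qed.

(** Extended to negative times by its value at 0, [f] is continuous on the line. *)
Lemma ac_measurable_gt0 (f : R -> R) : (forall b, 0 < b -> absolutely_continuous 0 b f) ->
  measurable [set t | 0 <= t /\ 0 < f t].
Proof.
move=> acf; pose A := [set t | 0 < f (Num.max 0 t)].
have -> : [set t | 0 <= t /\ 0 < f t] = `[0, +oo[%classic `&` A.
  apply/seteqP; split => t /=; rewrite /A/= in_itv/= andbT => -[t0]; first by rewrite max_r.
  by rewrite max_r.
apply: measurableI => //; apply: open_measurable; rewrite openE => t /= ft.
pose s := Num.max 0 t; have s0 : 0 <= s by rewrite le_max lexx.
have s1 : 0 < s + 1 by rewrite ltr_wpDl.
have [d d0 dP] := acf _ s1 _ ft.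
have key u v : 0 <= u -> u <= v -> v <= s + 1 -> v - u < d -> `|f v - f u| < f s.
  move=> u0 uv vs uvd; have := dP 1%N (fun=> u) (fun=> v) (fun=> conj u0 (conj uv vs)).
  by rewrite !big_ord1; apply=> //; move=> i j _ _ _; rewrite !ord1.
apply/nbhs_ballP; exists (Num.min 1 d) => [|v]; first by rewrite /= lt_min ltr01.
rewrite /ball/= lt_min => /andP[tv1 tvd]; rewrite /A/=; set w := Num.max 0 v.
have w0 : 0 <= w by rewrite le_max lexx.
have sw : `|s - w| <= `|t - v|.
  rewrite /s /w ler_norml; have := ler_norm (t - v); have := ler_norm (- (t - v)); rewrite normrN.
  have := normr_ge0 (t - v).
  by case: (leP 0 t); case: (leP 0 v) => ? ? ? ? ?; apply/andP; split; lra.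
have := le_lt_trans sw tv1; have := le_lt_trans sw tvd.
have [sw'|ws] := leP s w.
  rewrite distrC ger0_norm ?subr_ge0// => h1 h2.
  have := key s w s0 sw' ltac:(lra) h1; rewrite ltr_norml => /andP[]; lra.
rewrite ger0_norm ?subr_ge0 ?(ltW ws)// => h1 h2.
have := key w s w0 (ltW ws) ltac:(lra) h1; rewrite ltr_norml => /andP[]; lra.
Qed.

Section OneTrajectory.
Variables x z : link G -> R -> R.
Hypothesis tr : trajectory lambda c x z.
Let zt := truncated z.

Lemma trajectory_outflow i t : 0 <= t -> zt i t = outflow x zt i t.
Proof.
move=> t0; have [_ _ lp _ _] := tr.
have := lp_optimal_outflow Rsub (lp t t0 (fun=> 1) (fun=> ltr01)) i.
by rewrite /zt truncated_ge0E// /outflow inflow_truncated.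
Qed.

Lemma trajectory_history_ge0 i t : t < 0 -> 0 <= zt i t.
Proof.
move=> t0; rewrite /zt /truncated; case: ifP => // tm.
by have [_ /(_ i)[+ _] _ _ _] := tr; apply; rewrite tm.
Qed.

(** The linear program bounds departures from above only. But a negative part of the
    departures of [i] is inherited from the negative parts of the departures routed
    to [i], and the history has none. *)
Lemma trajectory_ge0 i t : 0 <= zt i t.
Proof.
pose e j s := Num.max 0 (- zt j s).
suff e0 : e i t = 0 by rewrite -oppr_le0 -e0 le_max lexx orbT.
apply: (causal_delayed_subsolution0 Rsub Gconn (e := e)) => [j s|j s s0|j s s0].
- by rewrite le_max lexx.
- by rewrite /e max_l// oppr_le0 trajectory_history_ge0.
have S0 : 0 <= \sum_k routing k j * e k (s - delay k j).
  by apply: sumr_ge0 => k _; rewrite mulr_ge0 ?routing_ge0// le_max lexx.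
rewrite ge_max S0 /= trajectory_outflow// /outflow; case: ifP => _; last first.
  by apply: le_trans S0; rewrite oppr_le0.
have [_|_] := leP (c j s) (inflow zt j s); first by apply: le_trans S0; rewrite oppr_le0.
rewrite /inflow opprD; apply: (@le_trans _ _ (- \sum_k routing k j * zt k (s - delay k j))).
  by rewrite gerDr oppr_le0.
rewrite -sumrN; apply: ler_sum => k _; rewrite -mulrN.
by apply: ler_wpM2l; [exact: routing_ge0|rewrite le_max lexx orbT].
Qed.

Lemma trajectory_le_capacity i t : 0 <= t -> zt i t <= c i t.
Proof. by move=> t0; rewrite trajectory_outflow// outflow_le. Qed.

(** Measurability at nonnegative times comes from the equations. Given the queues and
    the history, iterate the outflow equation from the capacities: the iterates are
    measurable, and their error is at most [C * inherited n]. *)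
Lemma trajectory_bmeas K : (forall i t, t < 0 -> zt i t <= K) -> forall i, bmeas (zt i).
Proof.
move=> zK; have [_ hz _ acx _] := tr.
have [C cC] : exists C, forall i t, c i t <= C.
  have [L cL] := choice (fun i => (bc i).2).
  exists (\sum_i `|L i|) => i t; apply: le_trans (ler_norm _) _.
  apply: le_trans (cL i t) _; apply: le_trans (ler_norm _) _.
  by apply: (@ler_sum_one _ _ (fun i => `|L i|)) => j.
pose h i t := if - max_delay_from i <= t < 0 then z i t else 0.
have hE i t : t < 0 -> h i t = zt i t.
  by move=> t0; rewrite /h /zt /truncated t0 andbT.
have bh i : bmeas (h i).
  apply: (@bmeas_history _ _ _ K); first by case: (hz i).
  move=> t /andP[mt t0]; rewrite -[z i t]/(z i t).
  have zE : z i t = zt i t by rewrite /zt /truncated mt.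
  by rewrite zE ger0_norm ?trajectory_ge0// zK.
pose A i := [set t | 0 <= t /\ 0 < x i t].
have mA i : measurable (A i) by apply: ac_measurable_gt0 => b b0; exact: acx.
pose Y := fix Y n : link G -> R -> R := fun i t =>
  if 0 <= t then (if n is n'.+1 then outflow x (Y n') i t else c i t) else h i t.
have mI : measurable (`[0, +oo[%classic : set R) by [].
have I0 t : (t \in `[0, +oo[%classic) = (0 <= t).
  by apply/idP/idP => [/set_mem|h0]; [|apply/mem_set]; rewrite /= in_itv/= andbT.
have [x0 _ _ _ _] := tr.
have bY n i : bmeas (Y n i).
  elim: n i => [|n IH] i.
    have := bmeas_if mI (bc i) (bh i); congr bmeas; apply/funext => t; by rewrite I0.
  have bin : bmeas (inflow (Y n) i) by apply: bmeas_inflow.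
  have := bmeas_if mI (bmeas_if (mA i) (bc i) (bmeas_min (bc i) bin)) (bh i).
  congr bmeas; apply/funext => t; rewrite I0 /=; case: ifP => // t0.
  rewrite /outflow; case: eqVneq => [xt|xt].
    by rewrite memNset//= /A/= xt ltxx => -[].
  by rewrite mem_set// /A/=; split=> //; rewrite lt_def xt x0.
have D n i t : `|Y n i t - zt i t| <= C * inherited n i.
  have C0 : 0 <= C by exact: le_trans (c0 i t) (cC i t).
  elim: n i t => [|n IH] i t /=.
    case: ifPn => [t0|]; last first.
      by rewrite -ltNge mulr1 => t0; rewrite hE// subrr normr0.
    rewrite mulr1 ger0_norm ?subr_ge0 ?trajectory_le_capacity//.
    by rewrite (le_trans _ (cC i t))// gerBl trajectory_ge0.
  case: ifPn => [t0|]; last first.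
    rewrite -ltNge => t0; rewrite hE// subrr normr0 mulr_ge0//.
    exact: (inherited_ge0 Rsub n.+1).
  rewrite trajectory_outflow//; apply: le_trans (dist_outflow Rsub _ _ _ _ _ _ _) _.
  rewrite mulr_sumr; apply: ler_sum => j _; rewrite mulrCA.
  by apply: ler_wpM2l; [exact: routing_ge0|exact: IH].
move=> i; split; last first.
  exists (Num.max K C) => t; rewrite ger0_norm ?trajectory_ge0// le_max.
  have [t0|/zK ->//] := leP 0 t.
  by apply/orP; right; exact: le_trans (trajectory_le_capacity i t0) (cC i t).
apply: (@measurable_fun_cvg _ _ _ _ (fun n => Y n i)) => [n|t _]; first exact: (bY n i).1.
have H : C * inherited n i @[n --> \oo] --> (0 : R).
  by rewrite -(mulr0 C); apply: cvgM; [exact: cvg_cst|exact: inherited_cvg0].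
apply/cvgrPdist_lt => e e0; near=> n; rewrite distrC.
apply: le_lt_trans (D n i t) _; near: n.
exact: (cvgr_lt _ H).
Unshelve. all: by end_near. Qed.

Lemma trajectory_derive i : {ae mu, forall t, 0 <= t ->
  is_derive t 1 (x i) (inflow zt i t - zt i t)}.
Proof.
have [_ _ _ _ dx] := tr; apply: filterS (dx i); first exact: (ae_filter_ringOfSetsType mu).
move=> t H t0; rewrite /zt inflow_truncated// truncated_ge0E// -inflowE; exact: H.
Qed.

End OneTrajectory.

End Trajectories.

(** * Convergence to the periodic regime *)
Lemma itv_integral_tail (R : realType) (f : R -> R) (C : R) : bmeas f ->
  (forall t, 0 <= f t) ->
  (forall b, 0 <= b -> itv_integral f 0 b <= C) ->
  forall e, 0 < e -> exists2 B, 0 <= B & forall u v, B <= u -> u <= v -> itv_integral f u v < e.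
Proof.
move=> bf f0 fC e e0; pose S := [set itv_integral f 0 b | b in [set b | 0 <= b]].
have hS : has_sup S.
  by split; [exists (itv_integral f 0 0), 0 => /=|exists C => _ [b /= b0 <-]; exact: fC].
have [_ [B /= B0 <-] SB] := sup_adherent e0 hS.
exists B => // u v Bu uv.
have h1 : itv_integral f 0 v <= sup S.
  by apply: sup_upper_bound => //; exists v => //=; rewrite (le_trans B0)// (le_trans Bu).
have h2 : itv_integral f 0 v = itv_integral f 0 u + itv_integral f u v by apply: itv_integral_chain => //; rewrite (le_trans B0).
have h3 : itv_integral f 0 u = itv_integral f 0 B + itv_integral f B u by apply: itv_integral_chain.
have h4 : 0 <= itv_integral f B u by apply: itv_integral_ge0.
lra.
Qed.

Lemma cvg_sum0 (R : realType) (I : finType) (f : I -> R -> R) :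
  (forall i, f i t @[t --> +oo] --> (0 : R)) -> \sum_i f i t @[t --> +oo] --> (0 : R).
Proof.
move=> f0; have E : \sum_(i : I) (0 : R) = 0 by rewrite big1.
rewrite -[X in _ --> X]E.
by apply: (@cvg_big _ _ _ _ _ _ _ _ _ f (fun=> 0)) => [|i _]; [exact: add_continuous|exact: f0].
Qed.

Section ConvergenceToRegime.
Context {R : realType} {G : roadNetwork R}.
Notation mu := (@lebesgue_measure R).
Hypotheses (Rsub : substochastic G) (Gconn : connectivity G).
Variables (lambda c : link G -> R -> R) (T : R).
Hypotheses (T0 : 0 < T)
  (bl : forall i, bmeas (lambda i)) (bc : forall i, bmeas (c i))
  (lT : forall i, has_period T (lambda i)) (cT : forall i, has_period T (c i))
  (l0 : forall i t, 0 <= lambda i t) (c0 : forall i t, 0 <= c i t)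
  (stable : forall i, itv_integral (lambda i) 0 T + \sum_j routing j i * itv_integral (c j) 0 T < itv_integral (c i) 0 T).
Implicit Types (i j : link G) (t s : R).
Notation inflow := (inflow lambda).
Notation outflow := (outflow lambda c).
Notation zs := (regime lambda c).
Definition regime_queue i := queue (net_inflow lambda c zs i).
Notation xs := regime_queue.

Let az : admissible c T zs.
Proof. exact: admissible_regime. Qed.
Let bzs i : bmeas (zs i). Proof. by case: (az i). Qed.
Let zsT i : has_period T (zs i). Proof. by case: (az i). Qed.
Let zs0 i t : 0 <= zs i t. Proof. by have [_ _ /(_ t)/andP[]] := az i. Qed.
Let zsc i t : zs i t <= c i t. Proof. by have [_ _ /(_ t)/andP[]] := az i. Qed.
Let bn i : bmeas (net_inflow lambda c zs i).
Proof. exact: (bmeas_net _ _ az). Qed.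
Let nT i t : itv_integral (net_inflow lambda c zs i) t (t + T) <= 0.
Proof. exact: (itv_integral_net_le0 Rsub T0 bl bc lT cT stable az). Qed.
Let xs0 i t : 0 <= xs i t. Proof. exact: (queue_ge0 (bn i) T0 (nT i)). Qed.
Let zsE i t : zs i t = outflow xs zs i t.
Proof. exact: (regimeE Rsub T0 bl bc lT cT l0 c0 stable). Qed.
Let xsT i t : xs i (t + T) = xs i t.
Proof. by apply: queue_periodic => //; exact: (periodic_net lT cT az). Qed.

Let xs_ac i a b : absolutely_continuous a b (xs i).
Proof.
have [K _ KP] := queue_lipschitz (bn i) T0 (nT i).
apply: (@ac_lipschitz _ _ K) => u v _ uv _; apply: le_trans (KP u v) _.
by rewrite ger0_norm// subr_ge0.
Qed.

Let xs_derive i : {ae mu, forall t, 0 <= t ->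
  is_derive t 1 (xs i) (inflow zs i t - zs i t)}.
Proof.
apply: filterS (queue_derive (bn i) T0 (nT i)); first exact: (ae_filter_ringOfSetsType mu).
move=> t H t0; have [dx net0] := H t0; move: dx; congr is_derive.
rewrite zsE /outflow -/(xs i t); case: eqVneq => [x0|x0].
  rewrite x0 ltxx; have := net0 x0; rewrite /net_inflow => h.
  by rewrite min_r ?subrr//; lra.
by rewrite ifT// lt_def x0 xs0.
Qed.

Lemma regime_periodic_trajectory : periodic_trajectory lambda c xs zs T.
Proof.
split; [|by move=> i t _; exact: xsT|by move=> i t _; exact: zsT].
split=> [//|j|t t0 eta eta0|i b _|i].
- split=> [t _|]; first exact: zs0.
  apply: integrableS (bmeas_integrable (- max_delay_from j) 0 (bzs j)) => //.
  by apply: subset_itvl; rewrite bnd_simp.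
- by apply: outflow_lp_optimal.
- exact: xs_ac.
- apply: filterS (xs_derive i); first exact: (ae_filter_ringOfSetsType mu).
  by move=> t H t0; rewrite inflowE; exact: H.
Qed.

(** The queues of the regime are periodic, so over a period departures balance
    arrivals, which are less than the capacity. *)
Lemma regime_spare_capacity i : itv_integral (zs i) 0 T < itv_integral (c i) 0 T.
Proof.
have bin : bmeas (inflow zs i) by exact: bmeas_inflow.
apply: le_lt_trans (itv_integral_inflow_lt Rsub T0 bl bc stable az i).
have := @ac_integral_eq _ (xs i) (fun t => inflow zs i t - zs i t) 0 T (ltW T0) (xs_ac i 0 T) (bmeasB bin (bzs i)).
rewrite -[in X in _ -> X - _ = _](add0r T) xsT subrr itv_integralB// => H.
suff : 0 = itv_integral (inflow zs i) 0 T - itv_integral (zs i) 0 T by lra.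
apply: H; apply: filterS (xs_derive i); first exact: (ae_filter_ringOfSetsType mu).
by move=> t H /andP[t0 _]; exact: H.
Qed.

Section Convergence.
Variables x z : link G -> R -> R.
Hypothesis tr : trajectory lambda c x z.
Let zt := truncated z.
Hypothesis bz : forall i, bmeas (zt i).

Let d i t := zt i t - zs i t.
Let y i t := x i t - xs i t.
Let bd i : bmeas (d i). Proof. exact: bmeasB. Qed.
Let bad i : bmeas (fun t => `|d i t|). Proof. exact: bmeas_norm. Qed.
Let D t := \sum_i `|d i t|.
Let bD : bmeas D. Proof. exact: bmeas_sum. Qed.
Let D0 t : 0 <= D t. Proof. by apply: sumr_ge0. Qed.
Let dD i u v : itv_integral (fun t => `|d i t|) u v <= itv_integral D u v.
Proof. by apply: itv_integral_le => // t _; exact: (@ler_sum_one _ _ (fun i => `|d i t|)). Qed.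

Let k i t := inflow zt i t - inflow zs i t - (zt i t - zs i t).
Let m i t := \sum_j routing j i * `|zt j (t - delay j i) - zs j (t - delay j i)| - `|zt i t - zs i t|.
Let bdel i j : bmeas (fun t => routing j i * `|zt j (t - delay j i) - zs j (t - delay j i)|).
Proof. by apply: bmeasZ; exact: (bmeas_shift (delay j i) (bad j)). Qed.
Let bm i : bmeas (m i).
Proof. by apply: bmeasB; [exact: bmeas_sum|exact: bad]. Qed.
Let bk i : bmeas (k i).
Proof. by apply: bmeasB; [apply: bmeasB; exact: bmeas_inflow|exact: bd]. Qed.

Let y_ac i b : 0 < b -> absolutely_continuous 0 b (y i).
Proof. by move=> b0; apply: acB; [case: tr => _ _ _ + _; exact|exact: xs_ac]. Qed.

Let y_derive i : {ae mu, forall t, 0 <= t -> is_derive t 1 (y i) (k i t)}.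
Proof.
apply: filterS2 (trajectory_derive Rsub tr i) (xs_derive i); first exact: (ae_filter_ringOfSetsType mu).
move=> t dx dxs t0; have := is_deriveB (dx t0) (dxs t0).
by congr is_derive; rewrite /k /zt; ring.
Qed.

Let ac_sub (f : R -> R) a b : 0 <= a -> absolutely_continuous 0 b f ->
  absolutely_continuous a b f.
Proof.
move=> a0 acf e e0; have [r r0 rP] := acf e e0; exists r => // n u v uv.
by apply: rP => l; have [h1 h2] := uv l; split=> //; exact: le_trans h1.
Qed.

Let y_le_integral i a b : 0 <= a -> a <= b -> `|y i b| - `|y i a| <= itv_integral (m i) a b.
Proof.
move=> a0 ab; have [b0|] := ltP 0 b; last first.
  move=> b0; have <- : a = b by apply/eqP; rewrite eq_le ab (le_trans b0).
  by rewrite subrr itv_integral_point.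
apply: (@ac_norm_le_integral _ (y i) (k i)) => //; first by apply: ac_sub => //; exact: y_ac.
apply: filterS (y_derive i); first exact: (ae_filter_ringOfSetsType mu).
move=> t dy /andP[at_ _]; have t0 := le_trans a0 at_; split; first exact: dy.
have [x0 _ _ _ _] := tr.
by apply: (queue_discrepancy Rsub (x0 i t t0) (xs0 i t) (trajectory_outflow Rsub tr i t0) (zsE i t)).
Qed.

Let y_dist i a b : 0 <= a -> a <= b -> `|y i b - y i a| <=
  itv_integral (fun t => `|k i t|) a b.
Proof.
move=> a0 ab; have [b0|] := ltP 0 b; last first.
  move=> b0; have <- : a = b by apply/eqP; rewrite eq_le ab (le_trans b0).
  by rewrite subrr normr0 itv_integral_point.
rewrite (@ac_integral_eq _ (y i) (k i) a b)//; [exact: itv_integral_abs|by apply: ac_sub => //; exact: y_ac|].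
apply: filterS (y_derive i); first exact: (ae_filter_ringOfSetsType mu).
by move=> t dy /andP[at_ _]; apply: dy; exact: le_trans at_.
Qed.

Let itv_integral_m i a b : itv_integral (m i) a b =
  \sum_j routing j i * itv_integral (fun t => `|d j t|) (a - delay j i) (b - delay j i)
  - itv_integral (fun t => `|d i t|) a b.
Proof.
rewrite /m (itv_integralB _ _ (bmeas_sum (bdel i)) (bad i)) (itv_integral_sum _ _ (bdel i)); congr (_ - _); apply: eq_bigr => j _.
rewrite itv_integralZ; last exact: (bmeas_shift (delay j i) (bad j)).
by congr (_ * _); exact: (itv_integral_shift (delay j i) a b (bad j)).
Qed.

(* Sum [y_le_integral] over the links with the weights: the arrivals of discrepancy from
   the upstream links are outweighed by its departures, and only the initial
   data remains. *)
Let D_bounded : exists C, forall b, 0 <= b -> itv_integral D 0 b <= C.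
Proof.
have [w [q [q0 _ w1 Rw]]] := routing_weights Rsub Gconn.
pose H j i := itv_integral (fun t => `|d j t|) (- delay j i) 0.
pose C := \sum_i w i * (`|y i 0| + \sum_j routing j i * H j i).
exists (C / q) => b b0; rewrite ler_pdivlMr//.
pose J j := itv_integral (fun t => `|d j t|) 0 b.
have J0 j : 0 <= J j by apply: itv_integral_ge0.
have -> : itv_integral D 0 b = \sum_j J j by exact: itv_integral_sum.
have step i : J i <= `|y i 0| + \sum_j routing j i * H j i + \sum_j routing j i * J j.
  have := y_le_integral i (lexx 0) b0; rewrite itv_integral_m -/(J i).
  have : \sum_j routing j i * itv_integral (fun t => `|d j t|) (0 - delay j i) (b - delay j i) <=
      \sum_j routing j i * H j i + \sum_j routing j i * J j.
    rewrite -big_split/=; apply: ler_sum => j _; rewrite -mulrDr.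
    apply: ler_wpM2l; first exact: routing_ge0.
    have dl := @delay_ge0 _ G j i.
    rewrite sub0r /H /J -itv_integral_chain// ?oppr_le0//; apply: itv_integral_subitv => //; lra.
  have := normr_ge0 (y i b); move: `|y i b| `|y i 0| (J i) => *; lra.
have h1 : \sum_i w i * J i <= C + \sum_i w i * (\sum_j routing j i * J j).
  rewrite -big_split/=; apply: ler_sum => i _; rewrite -mulrDr.
  by apply: ler_wpM2l; [case/andP: (w1 i) => /ltW|exact: step].
have h2 := sum_routed_weights J0 Rw.
have h3 : \sum_j (w j - q) * J j = \sum_j w j * J j - q * \sum_j J j.
  by rewrite mulr_sumr -sumrB; apply: eq_bigr => j _; rewrite mulrBl.
rewrite mulrC; lra.
Qed.

Let D_tail e : 0 < e -> exists2 B, 0 <= B & forall u v, B <= u -> u <= v ->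
  itv_integral D u v < e.
Proof. by have [C CP] := D_bounded; exact: (itv_integral_tail bD D0 CP). Qed.

Let history_cvg i j :
  routing j i * (\int[mu]_(s in `[t - delay j i, t]) `|z j s - zs j s|) @[t --> +oo] --> (0 : R).
Proof.
rewrite -(mulr0 (routing j i)); apply: cvgM; first exact: cvg_cst.
apply/cvgrPdist_lt => e e0; have [B B0 BP] := D_tail e0.
near=> t; have tB : B <= t - delay j i.
  by rewrite lerBrDr; near: t; apply: nbhs_pinfty_ge; rewrite num_real.
have dl := @delay_ge0 _ G j i.
rewrite sub0r normrN.
have -> : \int[mu]_(s in `[t - delay j i, t]) `|z j s - zs j s| =
    itv_integral (fun t => `|d j t|) (t - delay j i) t.
  apply: itv_integral_eq => s /andP[s1 _]; rewrite /d /zt truncated_ge0E//.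
  exact: le_trans B0 (le_trans tB s1).
rewrite ger0_norm; last by apply: itv_integral_ge0.
by apply: le_lt_trans (dD _ _ _) _; apply: BP => //; lra.
Unshelve. all: by end_near. Qed.

(* Late increments of [y i] are small. A late value of size at least [e] thus keeps
   its sign for a period [T], during which one of the queues is positive and its
   link departs at capacity. If it is the link of the trajectory, the departures
   would differ from those of the regime by the spare capacity [kap]; if it is that
   of the regime, there would be no spare capacity. *)
Let y_cvg i e : 0 < e -> exists2 B, 0 <= B & forall t, B <= t -> `|y i t| < e.
Proof.
move=> e0; pose M := 1 + \sum_j routing j i.
have M1 : 1 <= M by rewrite lerDl sumr_ge0// => j _; exact: routing_ge0.
have M0 : 0 < M by lra.
pose kap := itv_integral (c i) 0 T - itv_integral (zs i) 0 T.
have kap0 : 0 < kap by rewrite subr_gt0; exact: regime_spare_capacity.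
(* [M] times the tail of [D] bounds the late oscillations of [y i], and a tail
   below [kap] rules out a whole period of unequal service *)
pose eta := Num.min (e / M) kap.
have eta0 : 0 < eta by rewrite lt_min divr_gt0.
have [B B0 BP] := D_tail eta0.
pose del := \sum_j delay j i.
have del_ge j : delay j i <= del.
  by apply: (@ler_sum_one _ _ (fun j => delay j i)) => l; exact: delay_ge0.
have del0 : 0 <= del by apply: sumr_ge0 => j _; exact: delay_ge0.
have osc u v : B + del <= u -> u <= v -> `|y i v - y i u| < e.
  move=> Bu uv; have u0 : 0 <= u by lra.
  have me : M * eta <= e by rewrite mulrC -ler_pdivlMr// ge_min lexx.
  apply: lt_le_trans me; apply: le_lt_trans (y_dist i u0 uv) _.
  have kle t : `|k i t| <= \sum_j routing j i * `|d j (t - delay j i)| + `|d i t|.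
    apply: le_trans (ler_normB _ _) _; rewrite lerD2r; exact: dist_inflow.
  apply: (@le_lt_trans _ _ (itv_integral (fun t => \sum_j routing j i * `|d j (t - delay j i)| + `|d i t|) u v)).
    apply: itv_integral_le; [exact: bmeas_norm|by apply: bmeasD; [exact: bmeas_sum|]|by []].
  rewrite itv_integralD//; last exact: bmeas_sum.
  rewrite itv_integral_sum// mulrDl mul1r addrC.
  have h1 : itv_integral (fun t => `|d i t|) u v < eta.
    by apply: le_lt_trans (dD _ _ _) _; apply: BP => //; lra.
  apply: ltr_leD => //; rewrite mulr_suml; apply: ler_sum => j _.
  rewrite itv_integralZ; last exact: (bmeas_shift (delay j i) (bad j)).
  apply: ler_wpM2l; first exact: routing_ge0.
  rewrite (itv_integral_shift (delay j i) u v (bad j)); apply: ltW.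
  apply: le_lt_trans (dD _ _ _) _; apply: BP; last by rewrite lerD2r.
  by have := del_ge j; lra.
exists (B + del); first by rewrite addr_ge0.
move=> t tB; rewrite ltNge; apply/negP => yt.
have [x0 _ _ _ _] := tr.
have t0 : 0 <= t by lra.
have tT : t <= t + T by rewrite lerDl ltW.
have per f : bmeas f -> has_period T f -> itv_integral f t (t + T) = itv_integral f 0 T by exact: itv_integral_period.
have oscT s : t <= s -> `|y i s - y i t| < e by exact: osc.
have kapE : kap = itv_integral (fun s => c i s - zs i s) t (t + T) by rewrite itv_integralB// !per.
move: yt; rewrite ler_normr => /orP[yt|yt].
- have zc s : t <= s <= t + T -> c i s - zs i s <= `|d i s|.
    move=> /andP[ts _]; have s0 := le_trans t0 ts.
    have ys : 0 < y i s by have := oscT s ts; rewrite ltr_norml => /andP[]; move: (y i s) (y i t) yt => ys yt'; lra.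
    have xp : x i s != 0.
      by rewrite gt_eqF//; have := xs0 i s; move: ys; rewrite /y; lra.
    rewrite /d /zt (trajectory_outflow Rsub tr i s0) {1}/outflow (negbTE xp).
    exact: ler_norm.
  have : kap <= itv_integral (fun t => `|d i t|) t (t + T).
    by rewrite kapE; apply: itv_integral_le => //; exact: bmeasB.
  apply/negP; rewrite -ltNge; apply: le_lt_trans (dD _ _ _) _.
  apply: lt_le_trans (BP _ _ _ tT) _; first lra.
  by rewrite /eta ge_min lexx orbT.
- have zc s : t <= s <= t + T -> c i s - zs i s = 0.
    move=> /andP[ts _]; have s0 := le_trans t0 ts.
    have ys : y i s < 0 by have := oscT s ts; rewrite ltr_norml => /andP[]; move: (y i s) (y i t) yt => ys yt'; lra.
    have xp : xs i s != 0.
      by rewrite gt_eqF//; have := x0 i s s0; move: ys; rewrite /y; lra.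
    by rewrite zsE /outflow (negbTE xp) subrr.
  have : kap = 0.
    rewrite kapE (@itv_integral_eq _ _ (cst 0)); last by move=> s ts; rewrite zc.
    by rewrite itv_integral_cst// mul0r.
  by move=> kapE0; move: kap0; rewrite kapE0 ltxx.
Qed.

Lemma trajectory_converges : converges x z xs zs.
Proof.
split.
  apply: cvg_sum0 => i; apply/cvgrPdist_lt => e e0; have [B B0 BP] := y_cvg i e0.
  near=> t; rewrite sub0r normrN normr_id; apply: BP.
  by near: t; apply: nbhs_pinfty_ge; rewrite num_real.
by apply: cvg_sum0 => i; apply: cvg_sum0 => j; exact: history_cvg.
Unshelve. all: by end_near. Qed.

Lemma periodic_queue_eq : (forall i t, 0 <= t -> x i (t + T) = x i t) ->
  forall i t, 0 <= t -> x i t = xs i t.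
Proof.
move=> xT i t t0.
have yT n : y i (t + n%:R * T) = y i t.
  rewrite /y (periodic_nat n t (xsT i)); congr (_ - _).
  elim: n => [|n IH]; first by rewrite mul0r addr0.
  by rewrite -natr1 mulrDl mul1r addrA xT// addr_ge0// mulr_ge0// ltW.
suff : `|y i t| <= 0 by rewrite normr_le0 /y subr_eq0 => /eqP.
apply/ler_addgt0Pl => e e0; rewrite addr0; have [B B0 BP] := y_cvg i e0.
have BT : 0 <= B / T by rewrite divr_ge0// ltW.
have /andP[_] := trunc_itv BT; rewrite ltr_pdivrMr// => BT'.
by rewrite -(yT (Num.trunc (B / T)).+1) ltW// BP//; lra.
Qed.

End Convergence.

(** A periodic trajectory converges to the regime, so its queues are those of the
    regime. With equal queues, discrepancies between departures are inherited from
    upstream; periodicity moves them late enough for all delays to be looked up at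
    nonnegative times, where the departures are bounded. *)
Lemma periodic_trajectory_unique x z : periodic_trajectory lambda c x z T ->
  same_trajectory x z xs zs.
Proof.
move=> [tr xT zT]; have [x0 _ _ _ _] := tr.
pose zt := truncated z.
have zTn j t n : - max_delay_from j <= t -> z j (t + n%:R * T) = z j t.
  move=> tm; elim: n => [|n IH]; first by rewrite mul0r addr0.
  by rewrite -natr1 mulrDl mul1r addrA zT// ler_wpDr// mulr_ge0// ltW.
have later (t : R) : exists n, 0 <= t + n%:R * T.
  have tT : 0 <= `|t| / T by rewrite divr_ge0// ltW.
  have /andP[_] := trunc_itv tT; rewrite ltr_pdivrMr// => h.
  by exists (Num.trunc (`|t| / T)).+1; have := ler_norm (- t); rewrite normrN; lra.
have [C cC] : exists C, forall i t, c i t <= C.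
  have [L cL] := choice (fun i => (bc i).2).
  exists (\sum_i `|L i|) => i t; apply: le_trans (ler_norm _) _.
  apply: le_trans (cL i t) _; apply: le_trans (ler_norm _) _.
  by apply: (@ler_sum_one _ _ (fun i => `|L i|)) => j.
have zC i t : 0 <= t -> z i t <= C.
  move=> t0; rewrite -(truncated_ge0E z i t0).
  exact: le_trans (trajectory_le_capacity Rsub tr i t0) (cC i t).
have bz : forall i, bmeas (zt i).
  apply: (trajectory_bmeas Rsub Gconn bl bc l0 c0 tr (K := `|C|)) => i t _.
  rewrite /truncated; case: ifP => // tm; have [n tn] := later t.
  by rewrite -(zTn i t n tm) (le_trans (zC _ _ tn))// ler_norm.
have xE := periodic_queue_eq tr bz xT.
have zE i t : 0 <= t -> z i t = zs i t.
  move=> t0; apply/eqP; rewrite -subr_eq0 -normr_eq0; apply/eqP.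
  apply: (bounded_subsolution0 Rsub Gconn (X := R) (P := [set t | 0 <= t])
    (e := fun i t => `|z i t - zs i t|) (K := C + C)) => //= {t0}j s s0.
    rewrite normr_ge0 (le_trans (ler_normB _ _))// lerD// ger0_norm ?zC//.
      by rewrite -(truncated_ge0E z j s0); exact: (trajectory_ge0 Rsub Gconn l0 c0 tr).
    exact: le_trans (zsc _ _) (cC _ _).
  (* after [n] periods, every delayed time is nonnegative *)
  have [n nP] := later (- \sum_l delay l j).
  have nl l : 0 <= s + n%:R * T - delay l j.
    have : delay l j <= \sum_l delay l j.
      by apply: (@ler_sum_one _ _ (fun l => delay l j)) => l'; exact: delay_ge0.
    lra.
  exists (fun l => s + n%:R * T - delay l j) => //.
  have sn : 0 <= s + n%:R * T by rewrite addr_ge0// mulr_ge0// ltW.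
  have sm : - max_delay_from j <= s by rewrite (le_trans _ s0)// oppr_le0 max_delay_from_ge0.
  rewrite -(zTn j s n sm) -(periodic_nat n s (zsT j)).
  rewrite -(truncated_ge0E z j sn) (trajectory_outflow Rsub tr j sn) zsE.
  rewrite (_ : outflow xs zs j _ = outflow x zs j (s + n%:R * T)); last first.
    by rewrite /outflow xE.
  apply: le_trans (dist_outflow Rsub _ _ _ _ _ _ _) _; apply: ler_sum => l _.
  by rewrite truncated_ge0E.
split=> [i t|j t tm]; first exact: xE.
by have [n tn] := later t; rewrite -(zTn j t n tm) zE// periodic_nat.
Qed.

Lemma initially_piecewise_constant_converges x z : trajectory lambda c x z ->
  initially_piecewise_constant z -> converges x z xs zs.
Proof.
move=> tr pz; apply: trajectory_converges => //.
have [K KP] : exists K, forall j t, truncated z j t <= K \/ 0 <= t.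
  have [L cL] := choice (fun j => (piecewise_constant_bmeas (pz j).2).2).
  exists (\sum_i `|L i|) => j t; have [t0|t0] := leP 0 t; [by right|left].
  rewrite /truncated; case: ifP => [tm|_]; last by apply: sumr_ge0.
  have tm' : - max_delay G <= t < 0.
    by rewrite t0 andbT (le_trans _ tm)// lerN2 max_delay_from_le.
  have := cL j t; rewrite tm' => h.
  apply: le_trans (ler_norm _) _; apply: le_trans h _; apply: le_trans (ler_norm _) _.
  by apply: (@ler_sum_one _ _ (fun i => `|L i|)) => i.
apply: (trajectory_bmeas Rsub Gconn bl bc l0 c0 tr (K := K)) => i t t0.
by case: (KP i t) => //; rewrite leNgt t0.
Qed.

End ConvergenceToRegime.

(** The dynamics sees the inputs at nonnegative times only. *)
Lemma trajectory_inputs (R : realType) (G : roadNetwork R)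
    (lambda c lambda' c' : link G -> R -> R) :
  (forall i t, 0 <= t -> lambda i t = lambda' i t) -> (forall i t, 0 <= t -> c i t = c' i t) ->
  forall x z, trajectory lambda c x z -> trajectory lambda' c' x z.
Proof.
move=> ll' cc' x z [x0 hz lp acx dx].
have exoE i t : 0 <= t -> exo_inflow lambda' z i t = exo_inflow lambda z i t.
  by move=> t0; rewrite /exo_inflow ll'.
have feas t v : 0 <= t -> lp_feasible lambda c x z t v <-> lp_feasible lambda' c' x z t v.
  move=> t0; split=> -[h1 h2]; split=> i.
  - by rewrite -cc'.
  - by rewrite exoE//; exact: h2.
  - by rewrite cc'.
  - by rewrite -exoE//; exact: h2.
split=> // [t t0 eta eta0|i].
  have [h1 h2] := lp t t0 eta eta0; split; first exact/feas.
  by move=> w /(feas t w t0); exact: h2.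
apply: filterS (dx i); first exact: (ae_filter_ringOfSetsType lebesgue_measure).
by move=> t H t0; rewrite exoE//; exact: H.
Qed.

Theorem theorem1 (R : realType) (G : roadNetwork R)
  (Rsub : substochastic G) (Gconn : connectivity G)
  (lambda c : link G -> R -> R) (T : R) (T_gt0 : 0 < T)
  (lambda_ge0 : forall i (t : R), 0 <= t -> 0 <= lambda i t)
  (c_ge0 : forall i (t : R), 0 <= t -> 0 <= c i t)
  (lambda_pc : forall i, piecewise_constant 0 T (lambda i))
  (c_pc : forall i, piecewise_constant 0 T (c i))
  (lambda_periodic : forall i (t : R), 0 <= t -> lambda i (t + T) = lambda i t)
  (c_periodic : forall i (t : R), 0 <= t -> c i (t + T) = c i t)
  (stability : exists2 eps : R, 0 < eps &
     forall i, mean T (lambda i) + eps <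
       mean T (c i) - \sum_j routing j i * mean T (c j)) :
  exists xs zs : link G -> R -> R,
    [/\ periodic_trajectory lambda c xs zs T,
        forall x z, periodic_trajectory lambda c x z T ->
          same_trajectory x z xs zs &
        forall x z, trajectory lambda c x z ->
          initially_piecewise_constant z -> converges x z xs zs].
Proof.
have [L LP] := choice (fun i => periodic_extension T_gt0 (lambda_pc i) (lambda_periodic i) (lambda_ge0 i)).
have [C CP] := choice (fun i => periodic_extension T_gt0 (c_pc i) (c_periodic i) (c_ge0 i)).
have bL i : bmeas (L i) by case: (LP i).
have bC i : bmeas (C i) by case: (CP i).
have LT i : has_period T (L i) by case: (LP i).
have CT i : has_period T (C i) by case: (CP i).
have lL i t : 0 <= t -> lambda i t = L i t by case: (LP i) => _ _ + _; exact.
have cC i t : 0 <= t -> c i t = C i t by case: (CP i) => _ _ + _; exact.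
have L0 i t : 0 <= L i t by case: (LP i).
have C0 i t : 0 <= C i t by case: (CP i).
have stable i : itv_integral (L i) 0 T + \sum_j routing j i * itv_integral (C j) 0 T < itv_integral (C i) 0 T.
  have meanE (f F : R -> R) : (forall t, 0 <= t -> f t = F t) -> mean T f = T^-1 * itv_integral F 0 T.
    by move=> fF; congr (_ * _); apply: itv_integral_eq => t /andP[t0 _]; exact: fF.
  case: stability => eps eps0 /(_ i).
  rewrite (meanE _ _ (lL i)) (meanE _ _ (cC i)).
  under eq_bigr do rewrite (meanE _ _ (cC _)) mulrCA.
  rewrite -mulr_sumr -mulrBr => h.
  have : T^-1 * itv_integral (L i) 0 T < T^-1 * (itv_integral (C i) 0 T - \sum_j routing j i * itv_integral (C j) 0 T) by lra.
  by rewrite ltr_pM2l ?invr_gt0//; lra.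
have toL := trajectory_inputs lL cC.
have ofL : forall x z, trajectory L C x z -> trajectory lambda c x z.
  by apply: trajectory_inputs => i t t0; rewrite ?lL ?cC.
exists (regime_queue L C), (regime L C); split.
- have [tr xT zT] := regime_periodic_trajectory Rsub Gconn T_gt0 bL bC LT CT L0 C0 stable.
  by split=> //; exact: ofL.
- move=> x z [tr xT zT]; apply: (periodic_trajectory_unique Rsub Gconn T_gt0 bL bC LT CT L0 C0 stable).
  by split=> //; exact: toL.
- move=> x z tr; apply: (initially_piecewise_constant_converges Rsub Gconn T_gt0 bL bC LT CT L0 C0 stable).
  exact: toL.
Qed.
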